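(* Let $n\ge1$ and let $f:\Omega_n=\{-1,1\}^n\to\mathbb{C}$ be a function. Then: 1. $$\mathbb{E}e^{|f-\mathbb{E}f|}\le2\,\mathbb{E}e^{\frac{\pi^2}{32}|\nabla f|^2}\le2\,e^{\frac{\pi^2}{32}\Vert\,|\nabla f|\,\Vert_\infty^2}.$$ 2. For $0<\alpha<\frac12$, $$\mathbb{E}e^{|\Delta^\alpha f|}\le2\,\mathbb{E}e^{\frac12K_\alpha^2|\nabla f|^2}\le2\,e^{\frac12K_\alpha^2\Vert\,|\nabla f|\,\Vert_\infty^2},$$ where $K_\alpha=\frac1{\Gamma(1-\alpha)}\int_0^{\pi/2}(-\log\cos\theta)^{-\alpha}d\theta$.
   Context: $\Omega_n=\{-1,1\}^n$ carries the uniform probability, with expectation $\mathbb{E}$. For $x,y\in\Omega_n$, $xy$ is the coordinatewise product; $e_j\in\Omega_n$ has $-1$ in coordinate $j$ and $1$ elsewhere; $(\partial_jf)(x)=f(x)-f(xe_j)$; $|\nabla f|=(\sum_{j=1}^n|\partial_jf|^2)^{1/2}$ pointwise. With $\omega_j$ the coordinate functions and $\omega_A=\prod_{j\in A}\omega_j$ ($\omega_\emptyset=1$), the discrete Laplacian $\Delta=\sum_j\partial_j^*\partial_j$ (adjoint in $L^2(\Omega_n)$) satisfies $\Delta\omega_A=4|A|\omega_A$, and $\Delta^\alpha\omega_A=(4|A|)^\alpha\omega_A$ for $A\ne\emptyset$, $\Delta^\alpha1=0$, extended linearly. *)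

(* Defs.v *)
From HB Require Import structures.
From mathcomp Require Import all_boot all_order all_algebra.
From mathcomp Require Import all_classical all_reals all_analysis.
From mathcomp Require Export complex.

Set Implicit Arguments.
Unset Strict Implicit.
Unset Printing Implicit Defensive.

Import Order.TTheory GRing.Theory Num.Theory.

Local Open Scope ring_scope.
Local Open Scope complex_scope.

Section HammingCube.
Variable n : nat.

(* The bit b encodes the sign (-1) ^+ b, so the product of signs is addb. *)
Definition cube : predArgType := {ffun 'I_n -> bool}.

HB.instance Definition _ := Finite.on cube.

Definition cube_mul (x y : cube) : cube := [ffun i => x i (+) y i].

Definition cube_e (j : 'I_n) : cube := [ffun i => i == j].

Definition mean (K : numFieldType) (g : cube -> K) : K :=
  (\sum_(x : cube) g x) / #|cube|%:R.

Definition coord (K : nzRingType) (j : 'I_n) (x : cube) : K := (-1) ^+ x j.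

Definition walsh (K : comNzRingType) (A : {set 'I_n}) (x : cube) : K :=
  \prod_(j in A) coord K j x.

Variable R : realType.
Implicit Types (f : cube -> R[i]) (A B : {set 'I_n}).

(* The norm `|z| of R[i] is R[i]-valued; normc z : R is the real modulus. *)
Definition cmod (z : R[i]) : R := Normc.normc z.

Definition cube_partial (j : 'I_n) f (x : cube) : R[i] :=
  f x - f (cube_mul x (cube_e j)).

Definition grad_norm f (x : cube) : R :=
  Num.sqrt (\sum_(j < n) cmod (cube_partial j f x) ^+ 2).

(* For g >= 0 only, since the maximum starts at 0. *)
Definition sup_norm (g : cube -> R) : R := \big[Num.max/0]_(x : cube) g x.

(* The walsh functions are real, so no conjugate is needed in <f, walsh A>. *)
Definition fourier_coef f A : R[i] := mean (fun x => f x * walsh R[i] A x).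

Definition frac_laplacian (alpha : R) f (x : cube) : R[i] :=
  \sum_(A : {set 'I_n} | A != finset.set0)
     ((4 * #|A|)%:R `^ alpha)%:C * fourier_coef f A * walsh R[i] A x.

End HammingCube.

Section Constants.
Variable R : realType.

Definition Gamma (s : R) : R :=
  \int[@lebesgue_measure R]_(t in `]0, +oo[) (t `^ (s - 1) * expR (- t)).

Definition K_ (alpha : R) : R :=
  (Gamma (1 - alpha))^-1 *
  \int[@lebesgue_measure R]_(theta in `]0, (pi / 2)[)
     ((- ln (cos theta)) `^ (- alpha)).

End Constants.

Section Checks.
Variables (n : nat) (R : realType).
Implicit Types (A B : {set 'I_n}) (f g : cube n -> R[i]).

Lemma cube_mulK (e : cube n) : involutive (fun x => cube_mul x e).
Proof. by move=> x; apply/ffunP=> i; rewrite !ffunE addbK. Qed.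

Lemma coordM j (x y : cube n) :
  coord R[i] j (cube_mul x y) = coord R[i] j x * coord R[i] j y.
Proof. by rewrite /coord ffunE signr_addb. Qed.

Lemma walsh_e A j (x : cube n) :
  walsh R[i] A (cube_mul x (cube_e j)) = (-1) ^+ (j \in A) * walsh R[i] A x.
Proof.
rewrite /walsh; under eq_bigr do rewrite coordM.
rewrite big_split /= mulrC; congr (_ * _).
rewrite /coord; under eq_bigr do rewrite ffunE.
case: (boolP (j \in A)) => jA.
  rewrite (bigD1 j jA) /= eqxx big1 ?mulr1 // => i /andP[_ /negbTE].
  by rewrite eq_sym => ->.
rewrite big1 // => i iA; case: eqP => // ij.
by rewrite -ij iA in jA.
Qed.

Lemma fourier_coef_walsh A B :
  fourier_coef (@walsh n R[i] A) B = (A == B)%:R.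
Proof.
have N0 : #|cube n|%:R != 0 :> R[i].
  by rewrite pnatr_eq0 -lt0n; apply/card_gt0P; exists [ffun=> false].
rewrite /fourier_coef /mean; have [<-|AB] := eqVneq A B.
  under eq_bigr => x _.
    rewrite /walsh -big_split big1 /=; first over.
    by move=> j _; rewrite /coord -signr_addb addbb.
  by rewrite sumr_const divff.
have [j jAB] : exists j, (j \in A) != (j \in B).
  apply/existsP; apply: contraNT AB; rewrite negb_exists => /forallP H.
  by apply/eqP/setP => j; apply/eqP; move: (H j); rewrite negbK.
set S := \sum_x _; suff -> : S = 0 by rewrite mul0r.
have : S = - S.
  rewrite {1}/S (reindex_inj (inv_inj (cube_mulK (cube_e j)))) /= -sumrN.
  apply: eq_bigr => x _; rewrite !walsh_e mulrACA -signr_addb.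
  by move: jAB; case: (j \in A); case: (j \in B); rewrite //= mulN1r.
by move/eqP; rewrite -addr_eq0 -mulr2n mulrn_eq0 /= => /eqP.
Qed.

(* The L2 adjoint of cube_partial j is cube_partial j itself, so the Laplacian
   sum_j cube_partial j^* cube_partial j has eigenvalues 4 * #|A|. *)
Lemma cube_partial_selfadjoint j f g :
  mean (fun x => cube_partial j f x * (g x)^*) =
  mean (fun x => f x * (cube_partial j g x)^*).
Proof.
rewrite /mean /cube_partial; congr (_ / _).
under eq_bigr do rewrite mulrBl.
under [RHS]eq_bigr do rewrite rmorphB mulrBr.
rewrite !sumrB; congr (_ - _).
rewrite (reindex_inj (inv_inj (cube_mulK (cube_e j)))) /=.
by apply: eq_bigr => x _; rewrite cube_mulK.
Qed.

Lemma laplacian_walsh A x :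
  \sum_(j < n) cube_partial j (cube_partial j (@walsh n R[i] A)) x =
  (4 * #|A|)%:R * walsh R[i] A x.
Proof.
rewrite /cube_partial.
under eq_bigr => j _ do rewrite cube_mulK walsh_e.
rewrite (bigID (mem A)) /= [X in _ + X]big1 ?addr0; last first.
  by move=> j /negbTE ->; rewrite mul1r !subrr.
under eq_bigr => j jA do rewrite (idP jA) mulN1r.
rewrite sumr_const !opprB !opprK.
by rewrite -!mulr2n -!mulrnA mulr_natl mulnA.
Qed.


Lemma frac_laplacian_walsh alpha A x : A != finset.set0 ->
  frac_laplacian alpha (@walsh n R[i] A) x =
  ((4 * #|A|)%:R `^ alpha)%:C * walsh R[i] A x.
Proof.
move=> A0; rewrite /frac_laplacian (bigD1 A) //= fourier_coef_walsh eqxx mulr1.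
rewrite big1 ?addr0 // => B /andP[_ BA].
by rewrite fourier_coef_walsh eq_sym (negbTE BA) mulr0 mul0r.
Qed.

Lemma frac_laplacian1 alpha x :
  frac_laplacian alpha (@walsh n R[i] finset.set0) x = 0.
Proof.
rewrite /frac_laplacian big1 // => B B0.
by rewrite fourier_coef_walsh eq_sym (negbTE B0) mulr0 mul0r.
Qed.

Lemma frac_laplacian_linear alpha (c : R[i]) f g x :
  frac_laplacian alpha (fun y => c * f y + g y) x =
  c * frac_laplacian alpha f x + frac_laplacian alpha g x.
Proof.
rewrite /frac_laplacian mulr_sumr -big_split /=; apply: eq_bigr => A _.
suff -> : fourier_coef (fun y => c * f y + g y) A =
    c * fourier_coef f A + fourier_coef g A.
  by rewrite mulrDr mulrDl !mulrA (mulrC c).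
rewrite /fourier_coef /mean mulrA mulr_sumr -mulrDl -big_split /=.
by congr (_ / _); apply: eq_bigr => y _; rewrite mulrDl mulrA.
Qed.

End Checks.

(* Main.v *)
Require Import Defs.
From mathcomp Require Import all_boot all_order all_algebra.
From mathcomp Require Import all_classical all_reals all_analysis.
From mathcomp Require Import measurable_realfun.
From mathcomp Require Import ring lra.
Import Order.TTheory GRing.Theory Num.Theory.
Import numFieldNormedType.Exports.
Local Open Scope classical_set_scope.
Local Open Scope ring_scope.
Local Open Scope complex_scope.
Local Open Scope sesquilinear_scope.

(** Both inequalities follow from one fact about the family of functions
      s_t(f) = sum_A |A| sin t (cos t)^(|A|-1) fhat(A) w_A,   0 < t < pi/2,
    which is minus the derivative in t of the noise operator with parameter
    cos t applied to f.  Integrated against a suitable weight, s_t(f) gives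
    back f - E f (weight 1, total mass pi/2), or the multiplier |A|^alpha
    (weight (-ln cos t)^(-alpha) / Gamma(1-alpha), total mass K_alpha); the
    second identity is the integral of Gamma(1-alpha) after the substitution
    y = -k ln(cos t).  By convexity of cosh it then suffices to bound
    sum_x cosh |s_t(f)(x)| uniformly in t, with f scaled by the mass of the
    weight (mean_exp_multiplier_le).

    The bound for fixed t (sum_exp_rotation_le) is a trace inequality for
    matrices indexed by the cube.  Let T be the matrix whose entry at an edge
    (x, x e_j) is x_j d_j f(x), where d_j is half of the discrete derivative,
    and let u_x be the image of the standard basis under the n-fold tensor power
    of the rotation of R^2 by the angle t/2.  Then s_t(f)(x) = <u_x, T u_x>
    (rot_kernel_walsh), so a Hermitian dilation of T and the inequality of
    Peierls and Bogoliubov bound 2 sum_x cosh |s_t(f)(x)| by the trace of the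
    exponential of the dilation.

    The dilated edge matrices A_j of T satisfy D_j A_j D_j = - A_j and
    D_j A_i D_j = A_i for i != j, where D_j is the diagonal matrix of the j-th
    coordinate sign.  This symmetry plays the part of independent random signs
    and yields a noncommutative Khintchine inequality in exponential form,
      Tr exp(sum_j A_j) <= Tr exp((sum_j A_j^2) / 2)     (sum_exp_flip_le).
    It is proved by moving along c S + d V, with S = sum_j A_j and
    V = sum_j A_j^2, from (1, 0) to (0, 1/2): convexity of the trace of the
    exponential (Klein) controls each step by Tr S e^H <= c Tr V e^H, and that
    follows, one j at a time, from comparing H with D_j H D_j
    (tr_mul_exp_flip_le).  Here V is diagonal with entries |grad f|^2 / 4,
    which produces the right-hand sides; the factor 2 comes from
    exp r <= 2 cosh r. *)

(** * Traces of exponentials of Hermitian matrices *)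
Section SpectralTraces.
Context {R : realType} {N : nat}.
Local Notation C := (R[i]).
Implicit Types (P Q H A D X Y : 'M[C]_N) (a b : 'I_N -> R).

Lemma mulr_conj_cmod (z : C) : z * (z^*)%R = (cmod z ^+ 2)%:C.
Proof.
have -> : z * (z^*)%R = `|z| ^+ 2 by rewrite normCK.
by rewrite rmorphXn.
Qed.

(** Exponentials and other functions of a Hermitian matrix are handled through
    its spectral data: with P unitary, f(eigmx P a) is eigmx P (f \o a). *)
Definition eigmx P a : 'M[C]_N :=
  P^t* *m diag_mx (\row_i (a i)%:C) *m P.

Lemma tr_diag2 (a b : 'rV[C]_N) (B B' : 'M[C]_N) :
  \tr (diag_mx a *m (B *m (diag_mx b *m B')))
  = \sum_i \sum_j a 0 i * b 0 j * (B i j * B' j i).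
Proof.
rewrite /mxtrace; apply: eq_bigr => i _.
rewrite mul_diag_mx !mxE mulr_sumr; apply: eq_bigr => j _.
by rewrite mul_diag_mx !mxE mulrACA mulrA.
Qed.

Lemma adjmxM (A B : 'M[C]_N) : (A *m B)^t* = B^t* *m A^t*.
Proof. by rewrite trmx_mul map_mxM. Qed.

Lemma unitary_trC P : P \is unitarymx -> P^t* *m P = 1%:M.
Proof. by move=> /unitarymxP/mulmx1C. Qed.

Lemma unitary_row_sum P i : P \is unitarymx -> \sum_j cmod (P i j) ^+ 2 = 1.
Proof.
move=> /unitarymxP/matrixP/(_ i i); rewrite !mxE eqxx => H.
suff: (\sum_j cmod (P i j) ^+ 2)%:C = 1%:C by case.
rewrite [in RHS]/= -[RHS]H rmorph_sum /=; apply: eq_bigr => j _.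
by rewrite !mxE -mulr_conj_cmod.
Qed.

Lemma unitary_col_sum P j : P \is unitarymx -> \sum_i cmod (P i j) ^+ 2 = 1.
Proof.
move=> uP; have := @unitary_row_sum (P^t*) j; rewrite trmxC_unitary => /(_ uP).
move=> <-; apply: eq_bigr => i _; rewrite !mxE.
by congr (_ ^+ 2); case: (P i j) => x y; rewrite /cmod /= sqrrN.
Qed.

Lemma unitary_mul_trC P Q : P \is unitarymx -> Q \is unitarymx ->
  P *m Q^t* \is unitarymx.
Proof. by move=> uP uQ; apply: mul_unitarymx; rewrite ?trmxC_unitary. Qed.

(** The squared moduli of the overlaps between two orthonormal bases form a
    doubly stochastic matrix; it reduces trace inequalities between functions
    of two matrices to inequalities between numbers. *)
Lemma tr_eigmx2 P Q a b : P \is unitarymx -> Q \is unitarymx ->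
  \tr (eigmx P a *m eigmx Q b)
  = (\sum_i \sum_j a i * b j * cmod ((P *m Q^t*) i j) ^+ 2)%:C.
Proof.
move=> uP uQ; rewrite /eigmx -!mulmxA mxtrace_mulC -!mulmxA.
set Z := P *m Q^t*.
have -> : Q *m P^t* = Z^t* by rewrite adjmxM trmxCK.
rewrite (mulmxA P) -/Z tr_diag2 rmorph_sum; apply: eq_bigr => i _.
rewrite rmorph_sum; apply: eq_bigr => j _.
by rewrite !mxE mulr_conj_cmod -!rmorphM.
Qed.

Lemma eigmx_mul P a b : P \is unitarymx ->
  eigmx P a *m eigmx P b = eigmx P (fun i => a i * b i).
Proof.
move=> uP; rewrite /eigmx -!mulmxA (mulmxA P) (unitarymxP uP) mul1mx.
rewrite (mulmxA (diag_mx _) (diag_mx _)) mulmx_diag.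
congr (_ *m (diag_mx _ *m _)).
by apply/rowP => i; rewrite !mxE -rmorphM.
Qed.

Lemma tr_eigmx P a : P \is unitarymx -> \tr (eigmx P a) = (\sum_i a i)%:C.
Proof.
move=> uP; rewrite /eigmx -mulmxA mxtrace_mulC -mulmxA (unitarymxP uP) mulmx1.
by rewrite mxtrace_diag rmorph_sum; apply: eq_bigr => i _; rewrite mxE.
Qed.

Lemma expR_tangent (x y : R) : expR x + (y - x) * expR x <= expR y.
Proof.
have := expR_ge1Dx (y - x); rewrite -(ler_pM2r (expR_gt0 x)) -expRD subrK.
by rewrite mulrDl mul1r.
Qed.

(** The gradient inequality for the convex function Tr exp: in the overlap
    coordinates it is an average of the tangent inequalities of exp. *)
Lemma klein_inequality P Q a b : P \is unitarymx -> Q \is unitarymx ->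
  \sum_i expR (a i)
    + complex.Re (\tr ((eigmx Q b - eigmx P a) *m eigmx P (fun i => expR (a i))))
  <= \sum_j expR (b j).
Proof.
move=> uP uQ; rewrite mulmxBl linearB raddfB /= eigmx_mul // tr_eigmx //.
rewrite mxtrace_mulC (tr_eigmx2 _ _ _ _ uP uQ) /=.
set Z := P *m Q^t*.
have uZ : Z \is unitarymx by exact: unitary_mul_trC.
have row (g : 'I_N -> R) :
    \sum_i g i = \sum_i \sum_j g i * cmod (Z i j) ^+ 2.
  by apply: eq_bigr => i _; rewrite -mulr_sumr unitary_row_sum // mulr1.
have col (g : 'I_N -> R) :
    \sum_j g j = \sum_i \sum_j g j * cmod (Z i j) ^+ 2.
  rewrite exchange_big; apply: eq_bigr => j _.
  by rewrite -mulr_sumr unitary_col_sum // mulr1.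
have -> : \sum_i expR (a i) + (\sum_i \sum_j expR (a i) * b j
      * cmod (Z i j) ^+ 2 - \sum_i a i * expR (a i)) =
    \sum_i \sum_j (expR (a i) + (b j - a i) * expR (a i)) * cmod (Z i j) ^+ 2.
  rewrite (row (fun i => expR (a i))) (row (fun i => _ * _)).
  rewrite -sumrB -big_split /=; apply: eq_bigr => i _.
  rewrite -sumrB -big_split /=; apply: eq_bigr => j _.
  by rewrite -mulrBl -mulrDl mulrBl (mulrC (b j)).
rewrite (col (fun j => expR (b j))); apply: ler_sum => i _; apply: ler_sum => j _.
by rewrite ler_wpM2r ?sqr_ge0 // expR_tangent.
Qed.

Lemma tr_mul_eigmx A P a :
  \tr (A *m eigmx P a) = \sum_i (a i)%:C * (P *m A *m P^t*) i i.
Proof.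
rewrite /eigmx mulmxA mxtrace_mulC !mulmxA.
by rewrite /mxtrace; apply: eq_bigr => i _; rewrite mul_mx_diag !mxE mulrC.
Qed.

Lemma Re_sum (I : finType) (F : I -> C) :
  complex.Re (\sum_i F i) = \sum_i complex.Re (F i).
Proof. exact: (raddf_sum (@complex.Re R)). Qed.

Lemma Re_realM (x : R) (z : C) : complex.Re (x%:C * z) = x * complex.Re z.
Proof. by case: z => u v /=; rewrite mul0r subr0. Qed.

(** Klein's inequality for the diagonal part of the matrix in the basis Q: the
    first-order term then vanishes. *)
Lemma peierls_inequality P Q a : P \is unitarymx -> Q \is unitarymx ->
  \sum_j expR (complex.Re ((Q *m eigmx P a *m Q^t*) j j))
  <= \sum_i expR (a i).
Proof.
move=> uP uQ; set m := fun j => complex.Re ((Q *m eigmx P a *m Q^t*) j j).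
have := klein_inequality _ _ m a uQ uP.
rewrite mulmxBl linearB /= eigmx_mul // tr_eigmx //.
rewrite tr_mul_eigmx raddfB /= Re_sum; under [X in _ + (X - _)]eq_bigr do
  rewrite Re_realM mulrC.
by rewrite subrr addr0.
Qed.

Lemma adj_eigmx P a : (eigmx P a)^t* = eigmx P a.
Proof.
rewrite /eigmx !adjmxM trmxCK mulmxA tr_diag_mx map_diag_mx.
congr (_ *m diag_mx _ *m _).
by apply/rowP => i; rewrite !mxE; apply: conjc_real.
Qed.

(** The mean of exp over an interval is at most the mean of its endpoint values,
    by convexity (for x = y the left-hand side is 0). *)
Lemma expR_slope (x y : R) : (expR x - expR y) / (x - y) <= (expR x + expR y) / 2.
Proof.
wlog xy : x y / y < x => [H|].
  have [yx|xy|<-] := ltgtP y x; first exact: H.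
    by rewrite -mulrNN -invrN !opprB addrC (addrC (expR x)); rewrite addrC H.
  by rewrite !subrr mul0r divr_ge0 ?addr_ge0 ?expR_ge0.
rewrite ler_pdivrMr ?subr_gt0 //.
pose d := x - y.
(* After division by expR y the claim reads g 0 <= g d. *)
pose g (t : R) := t * (expR t + 1) / 2 - expR t.
have dg (t : R) : is_derive t 1 g (((expR t + 1) + t * expR t) / 2 - expR t).
  rewrite /g; apply: is_derive_eq.
  by rewrite !scaler0 /GRing.scale /=; ring.
have : g 0 <= g d.
  have d0 : 0 <= d by rewrite /d subr_ge0 ltW.
  apply: (@ger0_derive1_le_cc _ g 0 d) => //; rewrite ?in_itv /= ?lexx ?d0 //.
  - move=> t _; have [_] := dg t.
    rewrite derive1E => -> ; have := expR_ge1Dx (- t); rewrite expRN => h.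
    have : (1 - t) * expR t <= 1.
      by rewrite -ler_pdivlMr ?expR_gt0 // mul1r.
    by lra.
  - by apply: derivable_within_continuous => t _; have [] := dg t.
rewrite /g mul0r expR0 => h.
have -> : expR x = expR y * expR d.
  by rewrite /d expRD expRN mulrCA divff ?mulr1 ?expR_eq0.
rewrite -/d.
have := expR_gt0 y; nra.
Qed.

End SpectralTraces.

Section Duhamel.
Context {R : realType} {N : nat}.
Local Notation C := (R[i]).
Implicit Types (P Q H A D X Y : 'M[C]_N) (a b : 'I_N -> R).

(** A form of Duhamel's formula.  In overlap coordinates the matrix of A is the
    divided difference of the two spectra times the overlap, so the left-hand
    side is a combination of the slopes of exp with nonnegative weights
    |<p_i, A q_j>|^2, and expR_slope bounds each of them. *)
Lemma tr_mul_exp_diff_le P Q a b A (c : R) : P \is unitarymx -> Q \is unitarymx ->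
  A^t* = A -> 0 < c -> eigmx P a - eigmx Q b = (2 * c)%:C *: A ->
  complex.Re (\tr (A *m (eigmx P (fun i => expR (a i))
                         - eigmx Q (fun j => expR (b j)))))
  <= c * complex.Re (\tr (A *m A *m (eigmx P (fun i => expR (a i))
                         + eigmx Q (fun j => expR (b j))))).
Proof.
move=> uP uQ hA c0 E.
set Z := P *m Q^t*; set B := P *m A *m Q^t*.
(* Entrywise, the hypothesis says that 2 c B = diag(a) Z - Z diag(b). *)
have EB i j : (2 * c)%:C * B i j = (a i - b j)%:C * Z i j.
  have /(congr1 (fun M => (P *m M *m Q^t*) i j)) := E.
  rewrite -scalemxAr -scalemxAl -/B [X in _ = X]mxE => <-.
  rewrite mulmxBr mulmxBl /eigmx !mulmxA (unitarymxP uP) mul1mx.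
  rewrite -[X in _ - X]mulmxA (unitarymxP uQ) mulmx1.
  rewrite -(mulmxA _ P) -/Z mul_diag_mx mul_mx_diag !mxE rmorphB mulrBl.
  by rewrite [X in _ - X]mulrC.
have PP M : M *m P^t* *m P = M by rewrite -mulmxA unitary_trC // mulmx1.
have QQ M : M *m Q^t* *m Q = M by rewrite -mulmxA unitary_trC // mulmx1.
have hZ : Z^t* = Q *m P^t* by rewrite adjmxM trmxCK.
have hB : B^t* = Q *m A *m P^t* by rewrite !adjmxM trmxCK hA mulmxA.
have F1 : P *m A *m P^t* = B *m Z^t* by rewrite hZ /B mulmxA QQ.
have F2 : Q *m A *m Q^t* = Z^t* *m B by rewrite hZ /B !mulmxA PP.
have F3 : P *m (A *m A) *m P^t* = B *m B^t* by rewrite hB /B !mulmxA QQ.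
have F4 : Q *m (A *m A) *m Q^t* = B^t* *m B by rewrite hB /B !mulmxA PP.
clearbody Z B.
rewrite mulmxBr mulmxDr !raddfB !raddfD /= !tr_mul_eigmx F1 F2 F3 F4.
have -> : \sum_i (expR (a i))%:C * (B *m Z^t*) i i =
    \sum_i \sum_j (expR (a i))%:C * (B i j * (Z i j)^*%R).
  apply: eq_bigr => i _; rewrite mxE mulr_sumr; apply: eq_bigr => j _.
  by rewrite !mxE.
have -> : \sum_j (expR (b j))%:C * (Z^t* *m B) j j =
    \sum_i \sum_j (expR (b j))%:C * (B i j * (Z i j)^*%R).
  rewrite exchange_big; apply: eq_bigr => i _; rewrite mxE mulr_sumr.
  by apply: eq_bigr => j _; rewrite !mxE [X in _ * X]mulrC.
have -> : \sum_i (expR (a i))%:C * (B *m B^t*) i i =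
    \sum_i \sum_j (expR (a i))%:C * (cmod (B i j) ^+ 2)%:C.
  apply: eq_bigr => i _; rewrite mxE mulr_sumr; apply: eq_bigr => j _.
  by rewrite !mxE mulr_conj_cmod.
have -> : \sum_j (expR (b j))%:C * (B^t* *m B) j j =
    \sum_i \sum_j (expR (b j))%:C * (cmod (B i j) ^+ 2)%:C.
  rewrite exchange_big; apply: eq_bigr => i _; rewrite mxE mulr_sumr.
  by apply: eq_bigr => j _; rewrite !mxE [X in _ * X = _]mulrC mulr_conj_cmod.
rewrite !Re_sum -sumrB -big_split /= mulr_sumr; apply: ler_sum => i _.
rewrite !Re_sum -sumrB -big_split /= mulr_sumr; apply: ler_sum => j _.
rewrite !Re_realM /=.
have [ab|ab] := eqVneq (a i - b j) 0.
  have : B i j = 0.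
    have /eqP := EB i j; rewrite ab mul0r mulf_eq0 => /orP[|/eqP//].
    by move=> /eqP[] /eqP; rewrite mulf_eq0 pnatr_eq0 /= gt_eqF.
  move=> ->; have -> : cmod (0 : C) = 0.
    by rewrite /cmod /= expr0n addr0 sqrtr0.
  by rewrite mul0r expr0n /= !mulr0 subrr addr0 mulr0.
set r := cmod (B i j) ^+ 2.
have r0 : 0 <= r by rewrite sqr_ge0.
have Er : (a i - b j) * complex.Re (B i j * (Z i j)^*%R) = 2 * c * r.
  rewrite -Re_realM mulrCA.
  have -> : (a i - b j)%:C * (Z i j)^*%R = ((2 * c)%:C * B i j)^*%R.
    rewrite EB rmorphM /=; congr (_ * _); exact/esym/conjc_real.
  rewrite rmorphM /= mulrCA mulr_conj_cmod.
  have -> : ((2 * c)%:C^*)%R = (2 * c)%:C by exact: conjc_real.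
  by rewrite -rmorphM.
have -> : complex.Re (B i j * (Z i j)^*%R) = 2 * c * r / (a i - b j).
  by rewrite -Er mulrAC divff // mul1r.
have := expR_slope (a i) (b j); rewrite ler_pdivlMr // => h.
have := ler_wpM2l (mulr_ge0 (ltW c0) r0) h.
set k := (a i - b j)^-1; lra.
Qed.

End Duhamel.

(** * An exponential Khintchine inequality for sign-flipping matrices *)
Section Interpolation.
Context {R : realType} {N : nat}.
Local Notation C := (R[i]).
Implicit Types (P Q H A D X Y : 'M[C]_N) (a b : 'I_N -> R).

Lemma hermitian_eigmxP H : H^t* = H ->
  exists P a, P \is unitarymx /\ H = eigmx P a.
Proof.
move=> hH; have hs : H \is hermsymmx.
  by apply/is_hermitianmxP; rewrite expr0 scale1r.
exists (spectralmx H), (fun i => complex.Re (spectral_diag H 0 i)).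
split; first exact: spectral_unitarymx.
have hP : H = invmx (spectralmx H) *m diag_mx (spectral_diag H) *m spectralmx H.
  exact/orthomx_spectralP/hermitian_normalmx.
rewrite /eigmx -(invmx_unitary (spectral_unitarymx H)) [LHS]hP.
suff -> : \row_i (complex.Re (spectral_diag H 0 i))%:C = spectral_diag H by [].
apply/rowP => i; rewrite mxE.
have /mxOverP/(_ 0 i) := hermitian_spectral_diag_real hs.
by move=> /Creal_ReP; rewrite -complexRe.
Qed.

(** With H = eigmx P a, conjugation by D sends H to H - 2 c A and A to - A, so
    Tr A e^H is half of Tr A (e^H - e^(D H D)), while H and D H D give the same
    trace against A^2. *)
Lemma tr_mul_exp_flip_le P a A D (c : R) : P \is unitarymx -> A^t* = A ->
  D^t* = D -> D *m D = 1%:M -> D *m A *m D = - A -> 0 < c ->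
  D *m eigmx P a *m D = eigmx P a - (2 * c)%:C *: A ->
  complex.Re (\tr (A *m eigmx P (fun i => expR (a i))))
  <= c * complex.Re (\tr (A *m A *m eigmx P (fun i => expR (a i)))).
Proof.
move=> uP hA hD DD DA c0 DH.
have uD : D \is unitarymx by apply/unitarymxP; rewrite hD.
have uPD : P *m D \is unitarymx by exact: (mul_unitarymx uP uD).
have sD b : eigmx (P *m D) b = D *m eigmx P b *m D.
  by rewrite /eigmx adjmxM hD !mulmxA.
have DD' M : M *m D *m D = M by rewrite -mulmxA DD mulmx1.
have E : eigmx P a - eigmx (P *m D) a = (2 * c)%:C *: A.
  by rewrite (sD a) DH subKr.
have := tr_mul_exp_diff_le P (P *m D) a a A c uP uPD hA c0 E.
rewrite (sD (fun j => expR (a j))); move: (eigmx P _) => X.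
rewrite mulmxBr mulmxDr !raddfB !raddfD /=.
have -> : \tr (A *m (D *m X *m D)) = - \tr (A *m X).
  rewrite mulmxA mxtrace_mulC !mulmxA DA mulNmx; exact: raddfN.
have -> : \tr (A *m A *m (D *m X *m D)) = \tr (A *m A *m X).
  rewrite mulmxA mxtrace_mulC !mulmxA; congr (\tr (_ *m _)).
  by rewrite -(DD' _ (D *m A)) DA -!mulmxA (mulmxA D A D) DA mulNmx mulmxN opprK.
rewrite raddfN /=; lra.
Qed.

(** One step of the interpolation.  The loss of h in the coefficient of S is paid
    for by h c in the coefficient of V, since Tr S e^H <= c Tr V e^H at the
    starting point H, where the gradient inequality is applied. *)
Lemma sum_exp_step_le (I : finType) (A D : I -> 'M[C]_N) (c d h : R) :
  (forall i, (A i)^t* = A i) -> (forall i, (D i)^t* = D i) ->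
  (forall i, D i *m D i = 1%:M) -> (forall i, D i *m A i *m D i = - A i) ->
  (forall i j, i != j -> D i *m A j *m D i = A j) ->
  0 < c -> 0 <= h ->
  let S := \sum_i A i in let V := \sum_i A i *m A i in
  forall P Q a b, P \is unitarymx -> Q \is unitarymx ->
  eigmx P a = c%:C *: S + d%:C *: V ->
  eigmx Q b = (c - h)%:C *: S + (d + h * c)%:C *: V ->
  \sum_i expR (a i) <= \sum_i expR (b i).
Proof.
move=> hA hD DD DA DAj c0 h0 S V P Q a b uP uQ Ea Eb.
apply: le_trans (klein_inequality P Q a b uP uQ); rewrite lerDl Eb Ea.
have -> : (c - h)%:C *: S + (d + h * c)%:C *: V - (c%:C *: S + d%:C *: V) =
    h%:C *: (c%:C *: V - S).
  move: (S) (V) => S' V'; apply/matrixP => i j; rewrite !mxE !rmorphD rmorphN.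
  rewrite rmorphM; ring.
rewrite -scalemxAl mxtraceZ Re_realM mulr_ge0 //.
have key i : complex.Re (\tr (A i *m eigmx P (fun i => expR (a i))))
  <= c * complex.Re (\tr (A i *m A i *m eigmx P (fun i => expR (a i)))).
  apply: (@tr_mul_exp_flip_le P a (A i) (D i) c) => //.
  have DS : D i *m S *m D i = S - 2%:R *: A i.
    rewrite /S mulmx_sumr mulmx_suml (bigD1 i) //= DA [in RHS](bigD1 i) //=.
    rewrite (eq_bigr A) => [|j ji]; last by rewrite DAj // eq_sym.
    by rewrite addrAC scaler_nat mulr2n opprD addrA subrr sub0r.
  have DV : D i *m V *m D i = V.
    rewrite /V mulmx_sumr mulmx_suml; apply: eq_bigr => j _.
    have -> : D i *m (A j *m A j) *m D i =
        (D i *m A j *m D i) *m (D i *m A j *m D i).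
      by rewrite !mulmxA -(mulmxA (D i *m A j) (D i) (D i)) DD mulmx1.
    have [->|ij] := eqVneq i j; first by rewrite DA mulNmx mulmxN opprK.
    by rewrite DAj.
  rewrite Ea mulmxDr mulmxDl -!scalemxAr -!scalemxAl DS DV.
  rewrite scalerBr scalerA addrAC; congr (_ - _ *: _).
  by rewrite mulrC rmorphM rmorph_nat.
move: (eigmx P _) key => X key.
rewrite mulmxBl linearB raddfB /= subr_ge0 -scalemxAl mxtraceZ Re_realM.
have Rtr (F : I -> 'M[C]_N) :
    complex.Re (\tr (\sum_i F i)) = \sum_i complex.Re (\tr (F i)).
  by rewrite [\tr _]raddf_sum Re_sum.
rewrite /S /V !mulmx_suml !Rtr mulr_sumr.
by apply: ler_sum => i _; exact: key.
Qed.
End Interpolation.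

Section TraceComparison.
Context {R : realType} {N : nat}.
Local Notation C := (R[i]).
Implicit Types (P Q H A D X Y : 'M[C]_N) (a b : 'I_N -> R).

Lemma sum_expR_limit (I : finType) (v : I -> R) (T : R) :
  (forall m, T <= \sum_i expR ((1 + harmonic m) / 2 * v i)) ->
  T <= \sum_i expR (v i / 2).
Proof.
move=> H.
have cv : (fun m => \sum_i expR ((1 + harmonic m) / 2 * v i)) @ \oo
    --> \sum_i expR (v i / 2).
  apply: cvg_big => [|i _]; first exact: add_continuous.
  have -> : v i / 2 = (1 + 0) / 2 * v i by rewrite addr0 mulrC mul1r.
  apply: (@continuous_cvg _ _ _ _ _ _ (@expR R)); first exact: continuous_expR.
  apply: cvgM; last exact: cvg_cst.
  apply: cvgM; last exact: cvg_cst.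
  apply: cvgD; first exact: cvg_cst.
  exact: cvg_harmonic.
by apply: cvgr_to_ge cv _; apply: nearW.
Qed.

Lemma eigmx1 a : eigmx 1%:M a = diag_mx (\row_i (a i)%:C).
Proof. by rewrite /eigmx trmx1 map_mx1 mul1mx mulmx1. Qed.

(** A walk of m + 1 steps of length h = 1 / (m + 1) from S down to 0.  Its total
    cost is h * (h + 2 h + ... + (m + 1) h) = (1 + h) / 2 in the coefficient of
    V, and m tends to infinity. *)
Lemma sum_exp_flip_le (I : finType) (A D : I -> 'M[C]_N) (v : 'I_N -> R) P a :
  (forall i, (A i)^t* = A i) -> (forall i, (D i)^t* = D i) ->
  (forall i, D i *m D i = 1%:M) -> (forall i, D i *m A i *m D i = - A i) ->
  (forall i j, i != j -> D i *m A j *m D i = A j) ->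
  \sum_i A i *m A i = diag_mx (\row_i (v i)%:C) ->
  P \is unitarymx -> eigmx P a = \sum_i A i ->
  \sum_i expR (a i) <= \sum_i expR (v i / 2).
Proof.
move=> hA hD DD DA DAj EV uP ES; set S := \sum_i A i in ES.
have hS : S^t* = S by rewrite -ES adj_eigmx.
set V := diag_mx _ in EV.
have hV : V^t* = V by rewrite /V -eigmx1 adj_eigmx.
apply: sum_expR_limit => m; set h : R := harmonic m.
have h0 : 0 < h by exact: harmonic_gt0.
have chain k : forall d Q b, Q \is unitarymx ->
    eigmx Q b = (k%:R * h)%:C *: S + d%:C *: V ->
    \sum_i expR (b i)
      <= \sum_i expR ((d + h ^+ 2 * (k * k.+1)%:R / 2) * v i).
  elim: k => [|k IH] d Q b uQ EQ.
    have := @klein_inequality _ _ Q 1%:M b (fun i => d * v i) uQ.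
    rewrite eigmx1 EQ mul0r scale0r add0r.
    have -> : diag_mx (\row_i (d * v i)%:C) = d%:C *: V.
      by apply/matrixP => i j; rewrite !mxE rmorphM mulrnAr.
    rewrite subrr mul0mx mxtrace0 addr0 => /(_ _)/le_trans; apply.
      by apply/unitarymxP; rewrite trmx1 map_mx1 mulmx1.
    by rewrite mul0n mulr0 mul0r addr0.
  have [Q' [b' [uQ' EQ']]] : exists P a, P \is unitarymx /\
      (k%:R * h)%:C *: S + (d + h * (k.+1%:R * h))%:C *: V = eigmx P a.
    apply: hermitian_eigmxP; rewrite linearD /= !linearZ /= map_mxD !map_mxZ hS hV.
    have cR (x : R) : (x%:C^*)%R = x%:C by exact: conjc_real.
    by rewrite /= !cR.
  have := @sum_exp_step_le _ _ I A D (k.+1%:R * h) d h hA hD DD DA DAj _ _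
    Q Q' b b' uQ uQ'.
  rewrite -/S EV EQ -EQ' => /(_ _ _ erefl).
  have -> : k.+1%:R * h - h = k%:R * h by rewrite -natr1; ring.
  move=> /(_ _ _ erefl)/le_trans; apply; rewrite ?(ltW h0) ?mulr_gt0 //.
  apply: le_trans (IH _ _ _ uQ' (esym EQ')) _.
  have -> : d + h * (k.+1%:R * h) + h ^+ 2 * (k * k.+1)%:R / 2 =
      d + h ^+ 2 * (k.+1 * k.+2)%:R / 2.
    by rewrite !natrM -(natr1 k.+1) -(natr1 k); field.
  exact: lexx.
have hE : m.+1%:R * h = 1 by rewrite /h /harmonic divff.
have := chain m.+1 0 P a uP.
rewrite hE ES scale1r scale0r addr0 add0r => /(_ erefl).
suff -> : h ^+ 2 * (m.+1 * m.+2)%:R / 2 = (1 + h) / 2 by [].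
rewrite natrM -(natr1 m.+1); move: (m.+1%:R) hE => k hE.
have -> : h ^+ 2 * (k * (k + 1)) / 2 = ((k * h) ^+ 2 + h * (k * h)) / 2 by ring.
by rewrite hE expr1n mulr1.
Qed.

End TraceComparison.

(** * Hermitian dilation *)
Section Dilation.
Context {R : realType} {M : nat}.
Local Notation C := (R[i]).

Definition dilation (T : 'M[C]_M) : 'M[C]_(M + M) := block_mx 0 T (T^t*) 0.

Lemma adj_block_mx (K L O W : 'M[C]_M) :
  (block_mx K L O W)^t* = block_mx (K^t*) (O^t*) (L^t*) (W^t*).
Proof. by rewrite tr_block_mx map_block_mx. Qed.

Lemma adj0 : (0 : 'M[C]_M)^t* = 0.
Proof. by apply/matrixP => i j; rewrite !mxE rmorph0. Qed.

Lemma dilation_herm T : (dilation T)^t* = dilation T.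
Proof. by rewrite /dilation adj_block_mx !adj0 trmxCK. Qed.

Lemma dilation_sum (I : finType) (A : I -> 'M[C]_M) :
  dilation (\sum_i A i) = \sum_i dilation (A i).
Proof.
rewrite /dilation (eq_bigr (fun i => block_mx 0 (A i) ((A i)^t*) 0)) //.
elim/big_rec2: _ => [|i X Y _ <-].
  by rewrite adj0 block_mx_const.
by rewrite add_block_mx !addr0 linearD map_mxD.
Qed.

Lemma dilation_sqr T :
  dilation T *m dilation T = block_mx (T *m T^t*) 0 0 (T^t* *m T).
Proof.
rewrite /dilation mulmx_block !mul0mx !mulmx0 !add0r !addr0.
by congr block_mx.
Qed.

Lemma complex_phase (z : C) : exists w : C,
  w * (w^*)%R = 1 /\ z * (w^*)%R = (cmod z)%:C.
Proof.
have [->|z0] := eqVneq z 0.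
  exists 1; rewrite rmorph1 mulr1 mul0r; split => //.
  by rewrite /cmod /= expr0n addr0 sqrtr0.
exists (z / `|z|).
have nz : `|z| != 0 by rewrite normr_eq0.
have E : ((z / `|z|)^*)%R = (z^*)%R / `|z|.
  by rewrite rmorphM /= fmorphV /= (CrealP (normr_real z)).
split; first by rewrite E mulrACA -normCK expr2 mulrACA divff // mulr1.
by rewrite E mulrA -normCK expr2 mulfK.
Qed.

(** With T the sum of the A i, which need not be Hermitian, the dilation of T is
    Hermitian, and each diagonal entry z of U T U^* becomes two diagonal entries
    |z| and - |z| of the dilation in the basis of the vectors
    (u_x, +- phi_x u_x) / sqrt 2, where phi_x is the phase of z. *)
Lemma sum_exp_dilation_le (I : finType) (A D : I -> 'M[C]_M) (v : 'I_M -> R)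
    (U : 'M[C]_M) :
  (forall i, (D i)^t* = D i) ->
  (forall i, D i *m D i = 1%:M) -> (forall i, D i *m A i *m D i = - A i) ->
  (forall i j, i != j -> D i *m A j *m D i = A j) ->
  \sum_i A i *m (A i)^t* = diag_mx (\row_i (v i)%:C) ->
  \sum_i (A i)^t* *m A i = diag_mx (\row_i (v i)%:C) ->
  U \is unitarymx ->
  \sum_x (expR (cmod ((U *m (\sum_i A i) *m U^t*) x x))
         + expR (- cmod ((U *m (\sum_i A i) *m U^t*) x x)))
  <= 2 * \sum_x expR (v x / 2).
Proof.
move=> hD DD DA DAj V1 V2 uU; set T := \sum_i A i.
pose m x := cmod ((U *m T *m U^t*) x x).
rewrite -[X in X <= _]/(\sum_x (expR (m x) + expR (- m x))).
have [P [a [uP EP]]] := hermitian_eigmxP _ (dilation_herm T).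
pose E i : 'M[C]_(M + M) := block_mx (D i) 0 0 (D i).
pose w (k : 'I_(M + M)) :=
  match fintype.split k with inl x => v x | inr x => v x end.
have DdD i X : E i *m dilation X *m E i = dilation (D i *m X *m D i).
  rewrite /E /dilation !mulmx_block !mul0mx !mulmx0 !add0r !addr0 !mul0mx.
  by rewrite ?mulmx0 ?add0r ?addr0 !adjmxM hD mulmxA.
have main : \sum_i expR (a i) <= \sum_i expR (w i / 2).
  apply: (sum_exp_flip_le I (fun i => dilation (A i)) E w P a) => //.
  - by move=> i; exact: dilation_herm.
  - by move=> i; rewrite adj_block_mx hD adj0.
  - move=> i; rewrite mulmx_block !mul0mx !mulmx0 !add0r !addr0 DD.
    by rewrite -scalar_mx_block.
  - move=> i; rewrite DdD DA /dilation opp_block_mx oppr0.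
    by rewrite linearN map_mxN.
  - by move=> i j ij; rewrite DdD DAj.
  - under eq_bigr do rewrite dilation_sqr.
    have -> : \sum_i block_mx (A i *m (A i)^t*) 0 0 ((A i)^t* *m A i) =
       block_mx (\sum_i A i *m (A i)^t*) 0 0 (\sum_i (A i)^t* *m A i).
      elim/big_rec3: _ => [|i X Y Z _ ->]; first by rewrite block_mx_const.
      by rewrite add_block_mx !addr0.
    rewrite V1 V2 -diag_mx_row; congr diag_mx; apply/rowP => k.
    by rewrite !mxE /w; case: fintype.split => x; rewrite mxE.
  - by rewrite -EP dilation_sum.
have [phi hphi] := boolp.choice
  (fun x => complex_phase ((U *m T *m U^t*) x x)).
pose F := diag_mx (\row_x phi x).
have FF : F *m F^t* = 1%:M.
  rewrite tr_diag_mx map_diag_mx mulmx_diag; apply/matrixP => i j.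
  by rewrite !mxE; have [-> _] := hphi i.
pose c : C := (Num.sqrt (2^-1))%:C.
have cc : c * c = 2^-1.
  by rewrite /c -rmorphM -expr2 sqr_sqrtr ?invr_ge0 // fmorphV rmorph_nat.
have hc : (c^*)%R = c by exact: conjc_real.
pose Q : 'M[C]_(M + M) := c *: block_mx U (F *m U) U (- (F *m U)).
pose G := U *m T *m U^t* *m F^t*.
have Gx x : G x x = (m x)%:C.
  rewrite /G tr_diag_mx map_diag_mx mul_mx_diag !mxE.
  by have [_ <-] := hphi x; rewrite !mxE.
have hG : F *m U *m T^t* *m U^t* = G^t* by rewrite /G !adjmxM !trmxCK !mulmxA.
have FUUF : F *m U *m (F *m U)^t* = 1%:M.
  by rewrite adjmxM mulmxA -(mulmxA F) (unitarymxP uU) mulmx1.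
have hQ : Q^t* = c *: block_mx (U^t*) (U^t*) ((F *m U)^t*) (- (F *m U)^t*).
  by rewrite /Q linearZ map_mxZ /= hc adj_block_mx linearN map_mxN.
have uQ : Q \is unitarymx.
  apply/unitarymxP; rewrite hQ /Q -scalemxAl -scalemxAr scalerA cc.
  rewrite mulmx_block mulNmx !mulmxN mulNmx opprK FUUF (unitarymxP uU) subrr.
  rewrite scale_block_mx scaler0.
  have -> : 2^-1 *: (1%:M + 1%:M) = 1%:M :> 'M[C]_M.
    by apply/matrixP => i j; rewrite !mxE; field.
  by rewrite -scalar_mx_block.
have := peierls_inequality P Q a uP uQ; rewrite -EP.
have -> : Q *m dilation T *m Q^t* =
    2^-1 *: block_mx (G^t* + G) (G^t* - G) (- G^t* + G) (- (G^t* + G)).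
  rewrite hQ /Q -!scalemxAl -!scalemxAr scalerA cc /dilation !mulmx_block.
  rewrite ?mulmx0 ?add0r ?addr0.
  rewrite ?(mulNmx, mulmxN) hG.
  by rewrite [(F *m U)^t*]adjmxM !mulmxA -/G opprD.
move=> /le_trans/(_ main); rewrite !big_split_ord /=.
have -> : \sum_(i < M) expR (w (lshift M i) / 2) = \sum_x expR (v x / 2).
  by apply: eq_bigr => i _; rewrite /w (unsplitK (inl i)).
have -> : \sum_(i < M) expR (w (rshift M i) / 2) = \sum_x expR (v x / 2).
  by apply: eq_bigr => i _; rewrite /w (unsplitK (inr i)).
rewrite -[X in _ <= X]mulr2n mulr_natl big_split.
have half (x : R) : complex.Re (2^-1 * ((x%:C^*)%R + x%:C)) = x.
  have -> : (x%:C^*)%R = x%:C by exact: conjc_real.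
  rewrite -rmorphD -[2]/(2%:R) -(rmorph_nat (real_complex R)) -fmorphV -rmorphM.
  by rewrite /=; field.
clearbody G; congr (_ + _ <= _); apply: eq_bigr => x _.
  by rewrite mxE block_mxEul !mxE Gx; congr expR; exact: half.
rewrite mxE block_mxEdr !mxE Gx mulrN raddfN; congr (expR (- _)).
exact: half.
Qed.
End Dilation.

(** * Matrices indexed by the cube *)
Section KernelMatrix.
Context {R : realType} {J : finType}.
Local Notation C := (R[i]).
Implicit Types k l : J -> J -> C.

Definition kernel_mx k : 'M[C]_#|J| := \matrix_(i, j) k (enum_val i) (enum_val j).

Lemma sum_enum_val (V : nmodType) (F : J -> V) :
  \sum_(i < #|J|) F (enum_val i) = \sum_x F x.
Proof. by rewrite -(big_enum_val (A := J)); apply: eq_bigl. Qed.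

Lemma sum_delta (V : nmodType) (F : J -> V) x :
  \sum_y F y *+ (y == x) = F x.
Proof.
by rewrite (bigD1 x) //= eqxx big1 ?addr0 // => y /negbTE ->.
Qed.

Lemma kernel_mxM k l :
  kernel_mx k *m kernel_mx l = kernel_mx (fun x z => \sum_y k x y * l y z).
Proof.
apply/matrixP => i j; rewrite !mxE -sum_enum_val.
by apply: eq_bigr => h _; rewrite !mxE.
Qed.

Lemma adj_kernel_mx k : (kernel_mx k)^t* = kernel_mx (fun x y => (k y x)^*%R).
Proof. by apply/matrixP => i j; rewrite !mxE. Qed.

Lemma kernel_mx_sum (I : finType) (k : I -> J -> J -> C) :
  \sum_i kernel_mx (k i) = kernel_mx (fun x y => \sum_i k i x y).
Proof.
by apply/matrixP => i j; rewrite !mxE summxE; apply: eq_bigr => h _; rewrite mxE.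
Qed.

Lemma eq_kernel_mx k l : (forall x y, k x y = l x y) -> kernel_mx k = kernel_mx l.
Proof. by move=> kl; apply/matrixP => i j; rewrite !mxE kl. Qed.

Lemma kernel_mx_diag (v : J -> C) :
  kernel_mx (fun x y => v x *+ (x == y)) = diag_mx (\row_i v (enum_val i)).
Proof.
by apply/matrixP => i j; rewrite !mxE (inj_eq enum_val_inj).
Qed.

Lemma kernel_mx1 : kernel_mx (fun x y => (x == y)%:R) = 1%:M.
Proof.
by apply/matrixP => i j; rewrite !mxE (inj_eq enum_val_inj).
Qed.

End KernelMatrix.

Section CubeKernel.
Context {R : realType} {n : nat}.
Local Notation C := (R[i]).
Implicit Types (f : cube n -> C) (x y : cube n) (j : 'I_n).

Definition cube_flip x j : cube n := cube_mul x (cube_e j).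

Lemma cube_flipK j : involutive (cube_flip ^~ j).
Proof. exact: cube_mulK. Qed.

Lemma cube_flipE x j i : cube_flip x j i = x i (+) (i == j).
Proof. by rewrite !ffunE. Qed.

Definition edge (a : 'I_n -> cube n -> C) j x y : C :=
  a j x *+ (y == cube_flip x j).

(** The j-th coordinate sign is the diagonal involution that flips the edges in
    direction j only.  The symmetry of a across each edge makes both A_j A_j^*
    and A_j^* A_j equal to the diagonal matrix of |a_j|^2. *)
Lemma sum_edge_exp_le (a : 'I_n -> cube n -> C) (U : cube n -> cube n -> C)
    (m : cube n -> R) :
  (forall j x, a j (cube_flip x j) = a j x) ->
  (forall x x', \sum_y U x y * (U x' y)^*%R = (x == x')%:R) ->
  (forall x, m x =
    cmod (\sum_j \sum_y U x y * a j y * (U x (cube_flip y j))^*%R)) ->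
  \sum_x (expR (m x) + expR (- m x))
   <= 2 * \sum_x expR ((\sum_j cmod (a j x) ^+ 2) / 2).
Proof.
move=> sa hU hm.
pose A j := kernel_mx (edge a j).
pose D j : 'M[C]_#|cube n| := kernel_mx (fun x y => Defs.coord C j x *+ (x == y)).
have DE j k : D j *m kernel_mx k *m D j =
    kernel_mx (fun x y => Defs.coord C j x * Defs.coord C j y * k x y).
  rewrite /D kernel_mx_diag; apply/matrixP => p q.
  by rewrite mul_mx_diag mul_diag_mx !mxE mulrAC.
have co j x : Defs.coord C j x * Defs.coord C j x = 1.
  by rewrite /coord -signr_addb addbb.
pose v x := \sum_j cmod (a j x) ^+ 2.
have hA : \sum_j A j *m (A j)^t* = diag_mx (\row_i (v (enum_val i))%:C).
  rewrite -(kernel_mx_diag (fun x => (v x)%:C)).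
  under eq_bigr do rewrite adj_kernel_mx kernel_mxM.
  rewrite kernel_mx_sum; apply: eq_kernel_mx => x y; rewrite rmorph_sum -sumrMnl.
  apply: eq_bigr => j _; rewrite /edge.
  under eq_bigr do rewrite mulrnAl.
  rewrite sum_delta (inj_eq (inv_inj (cube_flipK j))).
  by have [->|_] := eqVneq x y; rewrite ?mulr1n ?mulr_conj_cmod ?rmorph0 ?mulr0.
have hA' : \sum_j (A j)^t* *m A j = diag_mx (\row_i (v (enum_val i))%:C).
  rewrite -(kernel_mx_diag (fun x => (v x)%:C)).
  under eq_bigr do rewrite adj_kernel_mx kernel_mxM.
  rewrite kernel_mx_sum; apply: eq_kernel_mx => x y; rewrite rmorph_sum -sumrMnl.
  apply: eq_bigr => j _; rewrite /edge.
  under eq_bigr => z _.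
    rewrite -(inj_eq (inv_inj (cube_flipK j))) cube_flipK eq_sym.
    rewrite rmorphMn mulrnAl; over.
  rewrite sum_delta cube_flipK sa eq_sym.
  case: eqVneq => [->|_]; last by rewrite mulr0.
  by rewrite [LHS]mulrC; exact: mulr_conj_cmod.
have uU : kernel_mx U \is unitarymx.
  apply/unitarymxP; rewrite adj_kernel_mx kernel_mxM -kernel_mx1.
  apply: eq_kernel_mx => x y.
  by rewrite hU.
have := sum_exp_dilation_le _ A D _ (kernel_mx U) _ _ _ _ hA hA' uU.
rewrite (sum_enum_val _ (fun x => expR (v x / 2))) -/v.
have mE i : cmod ((kernel_mx U *m (\sum_j A j) *m (kernel_mx U)^t*) i i)
    = m (enum_val i).
  rewrite /A kernel_mx_sum adj_kernel_mx !kernel_mxM mxE hm; congr cmod.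
  move: (enum_val i) => x.
  under eq_bigr => y _.
    rewrite mulr_suml; under eq_bigr do rewrite mulr_sumr mulr_suml; over.
  rewrite exchange_big /=; under eq_bigr do rewrite exchange_big /=.
  rewrite exchange_big /=; apply: eq_bigr => j _; apply: eq_bigr => y _.
  rewrite /edge; under eq_bigr do rewrite mulrnAr mulrnAl.
  by rewrite sum_delta.
under eq_bigr do rewrite mE.
rewrite (sum_enum_val _ (fun x => expR (m x) + expR (- m x))).
apply.
- move=> j; rewrite adj_kernel_mx; apply: eq_kernel_mx => x y.
  rewrite rmorphMn eq_sym.
  case: eqVneq => [->|//]; congr (_ *+ _).
  by rewrite /Defs.coord rmorphXn rmorphN1.
- move=> j; rewrite /D kernel_mx_diag mulmx_diag.
  by apply/matrixP => p q; rewrite !mxE co.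
- move=> j; rewrite DE; apply/matrixP => p q; rewrite !mxE /edge.
  case: eqVneq => [->|_]; last by rewrite mulr0 oppr0.
  by rewrite /Defs.coord cube_flipE eqxx signr_addb mulrA -expr2 sqrr_sign
    mul1r mulN1r.
- move=> j k jk; rewrite DE; apply: eq_kernel_mx => x y; rewrite /edge.
  case: eqVneq => [->|_]; last by rewrite mulr0.
  by rewrite /Defs.coord cube_flipE (negbTE jk) addbF -expr2 sqrr_sign mul1r.
Qed.
End CubeKernel.

(** * Rotations of the cube and Fourier multipliers *)
Section Rotation.
Context {R : realType} {n : nat}.
Local Notation C := (R[i]).
Implicit Types (f : cube n -> C) (x y : cube n) (j : 'I_n) (A : {set 'I_n}).

Lemma sum_cube_prod (V : comNzRingType) (F : 'I_n -> bool -> V) :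
  \sum_(y : cube n) \prod_i F i (y i) = \prod_i (F i false + F i true).
Proof.
under [RHS]eq_bigr => i _ do rewrite addrC -(big_bool _ (F i)).
by rewrite bigA_distr_bigA.
Qed.

(** The kernel sum_A w_A(y) w_A(x) is the product of the factors 1 + x_i y_i,
    hence 2^n on the diagonal and 0 off it. *)
Lemma fourier_inversion f x :
  f x = \sum_(A : {set 'I_n}) fourier_coef f A * walsh C A x.
Proof.
have E A : fourier_coef f A * walsh C A x =
    \sum_y f y / #|cube n|%:R * (walsh C A y * walsh C A x).
  rewrite /fourier_coef /mean -mulrA mulr_suml; apply: eq_bigr => y _.
  by rewrite !mulrA; congr (_ * _); rewrite mulrAC.
under eq_bigr do rewrite E.
rewrite exchange_big /=; under eq_bigr do rewrite -mulr_sumr.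
have S y : \sum_(A : {set 'I_n}) walsh C A y * walsh C A x
    = #|cube n|%:R *+ (y == x).
  transitivity (\prod_i (Defs.coord C i y * Defs.coord C i x + 1)).
    rewrite bigA_distr; apply: eq_big => [A|A _]; first by rewrite inE.
    by rewrite /walsh -big_split /= big_mkcond.
  have [->|yx] := eqVneq y x.
    rewrite mulr1n card_ffun card_bool card_ord natrX.
    rewrite (eq_bigr (fun=> 2)) => [|i _]; first by rewrite prodr_const card_ord.
    by rewrite /Defs.coord -signr_addb addbb.
  have [i yi] : exists i, y i != x i.
    apply/existsP; apply: contraNT yx; rewrite negb_exists => /forallP H.
    by apply/eqP/ffunP => i; apply/eqP; move: (H i); rewrite negbK.
  rewrite (bigD1 i) //= /Defs.coord -signr_addb.
  by move: yi; case: (y i); case: (x i) => //= _; rewrite expr1 addNr mul0r.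
under eq_bigr do rewrite S mulrnAr.
rewrite sum_delta mulfVK // pnatr_eq0 -lt0n; apply/card_gt0P.
by exists x.
Qed.

(** The rotation matrix ((c, s), (- s, c)), with rows and columns indexed by the
    signs (-1)^b. *)
Definition rot (c s : R) (b b' : bool) : R :=
  if b == b' then c else (-1) ^+ b * s.

Definition rot_kernel (c s : R) x y : R := \prod_i rot c s (x i) (y i).

Lemma rot_kernel_orthonormal (c s : R) x x' : c ^+ 2 + s ^+ 2 = 1 ->
  \sum_y rot_kernel c s x y * rot_kernel c s x' y = (x == x')%:R.
Proof.
move=> cs1; under eq_bigr do rewrite /rot_kernel -big_split.
rewrite (sum_cube_prod _ (fun i b => rot c s (x i) b * rot c s (x' i) b)).
have E i : rot c s (x i) false * rot c s (x' i) false
    + rot c s (x i) true * rot c s (x' i) true = (x i == x' i)%:R.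
  rewrite -cs1 /rot; case: (x i); case: (x' i) => /=; ring.
under eq_bigr do rewrite E.
have [->|xx] := eqVneq x x'; first by rewrite big1 // => i _; rewrite eqxx.
have [i yi] : exists i, x i != x' i.
  apply/existsP; apply: contraNT xx; rewrite negb_exists => /forallP H.
  by apply/eqP/ffunP => i; apply/eqP; move: (H i); rewrite negbK.
by rewrite (bigD1 i) //= (negbTE yi) mul0r.
Qed.

(** The sum factors over the coordinates.  The j-th factor couples the two ends
    of the edge and gives 2 c s x_j; a factor i in A other than j gives
    (c^2 - s^2) x_i; the other factors give c^2 + s^2 = 1. *)
Lemma rot_kernel_walsh (c s : R) x j A : c ^+ 2 + s ^+ 2 = 1 -> j \in A ->
  \sum_y rot_kernel c s x y * (Defs.coord R j y * walsh R A y)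
     * rot_kernel c s x (cube_flip y j)
  = 2 * c * s * (c ^+ 2 - s ^+ 2) ^+ #|A|.-1 * walsh R A x.
Proof.
move=> cs1 jA.
pose F i b := rot c s (x i) b * rot c s (x i) (b (+) (i == j))
  * (if i == j then (-1) ^+ b else 1) * (if i \in A then (-1) ^+ b else 1).
transitivity (\sum_(y : cube n) \prod_i F i (y i)).
  apply: eq_bigr => y _; rewrite /F !big_split /= -!big_mkcond /= big_pred1_eq.
  rewrite /rot_kernel /walsh /Defs.coord.
  under [X in _ * X = _]eq_bigr do rewrite cube_flipE.
  ring.
rewrite sum_cube_prod.
have E i : F i false + F i true =
   (if i == j then 2 * c * s else 1)
   * (if i \in A :\ j then c ^+ 2 - s ^+ 2 else 1)
   * (if i \in A then Defs.coord R i x else 1).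
  rewrite /F in_setD1 /rot /Defs.coord.
  have [->|ij] := eqVneq i j.
    by rewrite jA; case: (x j) => /=; ring.
  case: (i \in A); first by case: (x i) => /=; ring.
  transitivity (c ^+ 2 + s ^+ 2); first by case: (x i) => /=; ring.
  by rewrite cs1 /= !mulr1.
rewrite (eq_bigr _ (fun i _ => E i)) !big_split /= -!big_mkcond /=.
rewrite big_pred1_eq prodr_const; congr (_ * _ ^+ _ * _).
by rewrite [in RHS](cardsD1 j) jA.
Qed.

Lemma walshC A x : walsh C A x = (walsh R A x)%:C.
Proof.
rewrite /walsh rmorph_prod; apply: eq_bigr => i _.
by rewrite /Defs.coord rmorphXn rmorphN1.
Qed.

Lemma cube_partial_fourier f j y :
  cube_partial j f y / 2
  = \sum_(A : {set 'I_n} | j \in A) fourier_coef f A * walsh C A y.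
Proof.
rewrite /cube_partial (fourier_inversion f y).
rewrite (fourier_inversion f (cube_mul _ _)) -sumrB mulr_suml.
rewrite [RHS]big_mkcond; apply: eq_bigr => A _.
rewrite walsh_e -mulrBr -mulrA; case: (j \in A).
  by rewrite expr1 mulN1r opprK; field.
by rewrite mul1r subrr mul0r mulr0.
Qed.

(** The parameter h takes the cardinal of A, so these are the functions of the
    Laplacian. *)
Definition fourier_multiplier (h : nat -> R) f x : C :=
  \sum_(A : {set 'I_n}) (h #|A|)%:C * fourier_coef f A * walsh C A x.

Lemma cmodM (z w : C) : cmod (z * w) = cmod z * cmod w.
Proof. exact: Normc.normcM. Qed.

Lemma cmodR (t : R) : cmod (t%:C : C) = `|t|.
Proof. by rewrite /cmod /= expr0n addr0 sqrtr_sqr. Qed.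

(** For c = cos (t/2) and s = sin (t/2) this is k sin t (cos t)^(k-1), minus the
    derivative of (cos t)^k. *)
Definition rot_weight (c s : R) (k : nat) : R :=
  k%:R * (2 * c * s * (c ^+ 2 - s ^+ 2) ^+ k.-1).

(** The multiplier evaluated at x is the diagonal entry at u_x of the matrix with
    edge weights x_j d_j f(x), with d_j half of the discrete derivative: each
    Walsh function w_A is reached once from every j in A, whence the factor
    |A| of rot_weight. *)
Lemma sum_exp_rotation_le (c s : R) f : c ^+ 2 + s ^+ 2 = 1 ->
  \sum_x (expR (cmod (fourier_multiplier (rot_weight c s) f x))
         + expR (- cmod (fourier_multiplier (rot_weight c s) f x)))
  <= (2 * \sum_x expR (grad_norm f x ^+ 2 / 8) : R).
Proof.
move=> cs1.
pose a j x : C := Defs.coord C j x * (cube_partial j f x / 2).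
pose U x y : C := (rot_kernel c s x y)%:C.
have cR (x : R) : (x%:C^*)%R = x%:C by exact: conjc_real.
set m := fun x => cmod (fourier_multiplier (rot_weight c s) f x).
have := sum_edge_exp_le a U m.
have -> : \sum_x expR ((\sum_j cmod (a j x) ^+ 2) / 2)
    = \sum_x expR (grad_norm f x ^+ 2 / 8).
  apply: eq_bigr => x _; congr expR.
  rewrite /grad_norm sqr_sqrtr; last by apply: sumr_ge0 => j _; exact: sqr_ge0.
  rewrite !mulr_suml; apply: eq_bigr => j _.
  have -> : cmod (a j x) = cmod (cube_partial j f x) / 2.
    rewrite /a mulrA mulrAC [LHS]cmodM mulrC; congr (_ * _).
    have -> : Defs.coord C j x / 2 = ((-1) ^+ x j / 2)%:C.
      by rewrite /Defs.coord rmorphM rmorphXn rmorphN1 fmorphV rmorph_nat.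
    by rewrite cmodR normrM normr_sign mul1r ger0_norm // invr_ge0.
  by field.
apply.
- move=> j x; rewrite /a /cube_partial.
  rewrite -/(cube_flip x j) -/(cube_flip _ j) cube_flipK.
  rewrite {1}/Defs.coord cube_flipE eqxx signr_addb mulrN1 /Defs.coord.
  by rewrite mulNr -mulrN -mulNr opprB.
- move=> x x'; under eq_bigr do rewrite /U cR -rmorphM.
  by rewrite -rmorph_sum rot_kernel_orthonormal // rmorph_nat.
- move=> x; rewrite /m /fourier_multiplier; congr cmod.
  transitivity (\sum_j \sum_(A : {set 'I_n} | j \in A) fourier_coef f A *
    (2 * c * s * (c ^+ 2 - s ^+ 2) ^+ #|A|.-1 * walsh R A x)%:C); last first.
    apply: eq_bigr => j _.
    have aE y : a j y = \sum_(A : {set 'I_n} | j \in A)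
        fourier_coef f A * (Defs.coord R j y * walsh R A y)%:C.
      rewrite /a cube_partial_fourier mulr_sumr; apply: eq_bigr => A _.
      rewrite walshC mulrCA rmorphM; congr (_ * (_ * _)).
      by rewrite /Defs.coord rmorphXn rmorphN1.
    under [RHS]eq_bigr do rewrite aE mulr_sumr mulr_suml.
    rewrite exchange_big /=; apply: eq_bigr => A jA.
    rewrite -(rot_kernel_walsh c s x j A cs1 jA) rmorph_sum mulr_sumr.
    apply: eq_bigr => y _; rewrite /U cR !rmorphM; ring.
  rewrite (exchange_big_dep predT) //=; apply: eq_bigr => A _.
  rewrite sumr_const walshC /rot_weight -[RHS]mulr_natl rmorphM rmorph_nat.
  rewrite [X in _ = _ * (_ * X)]rmorphM; ring.
Qed.
End Rotation.

(** * Averaging over the rotation angle *)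
Section HasIntegral.
Context {R : realType}.
Local Notation mu := (@lebesgue_measure R).
Implicit Types (D : set (measurableTypeR R)) (F G : R -> R) (u v c : R).

(** Integrability and value together, so that both pass through finite linear
    combinations at once. *)
Definition has_integral D F v : Prop :=
  mu.-integrable D (EFin \o F) /\ \int[mu]_(t in D) F t = v.

Lemma has_integralZ D F v c : measurable D ->
  has_integral D F v -> has_integral D (fun t => c * F t) (c * v).
Proof.
move=> mD [iF <-]; split; last by rewrite RintegralZl.
by apply: (eq_integrable mD _ _ _ (integrableZl mD c iF)) => t _.
Qed.

Lemma has_integralD D F G u v : measurable D -> has_integral D F u ->
  has_integral D G v -> has_integral D (fun t => F t + G t) (u + v).
Proof.
move=> mD [iF <-] [iG <-]; split; last by rewrite RintegralD.
by apply: (eq_integrable mD _ _ _ (integrableD mD iF iG)) => t _.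
Qed.

Lemma has_integral_sum (I : finType) D (F : I -> R -> R) (v : I -> R) :
  measurable D -> (forall i, has_integral D (F i) (v i)) ->
  has_integral D (fun t => \sum_i F i t) (\sum_i v i).
Proof.
move=> mD iF.
have [] : has_integral D (\sum_(i <- index_enum I) F i)
    (\sum_(i <- index_enum I) v i).
  elim/big_rec2: _ => [|i y G _ iG]; last exact: has_integralD.
  split; first exact: integrable0.
  by apply: etrans (mul0r (fine (mu D))); exact: (Rintegral_cst mu mD 0).
rewrite (_ : (\sum_i F i)%R = (fun t => \sum_i F i t)) //.
by apply/funext => t; rewrite fct_sumE.
Qed.

Lemma has_integral_le D F G u v : measurable D -> has_integral D F u ->
  has_integral D G v -> (forall t, D t -> F t <= G t) -> u <= v.
Proof. by move=> mD [iF <-] [iG <-] FG; exact: le_Rintegral. Qed.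

End HasIntegral.

Section Jensen.
Context {R : realType} {n : nat}.
Local Notation C := (R[i]).

(** The tangent of 2 cosh at r0, where u stands for the real part of a number of
    modulus r. *)
Lemma cosh_tangent (r0 r u : R) : 0 <= r0 -> u <= r ->
  (expR r0 + expR (- r0)) + (expR r0 - expR (- r0)) * (u - r0)
  <= expR r + expR (- r).
Proof.
move=> r00 ur; have h1 := expR_tangent r0 r; have h2 := expR_tangent (- r0) (- r).
have h3 : (expR r0 - expR (- r0)) * (u - r0)
    <= (expR r0 - expR (- r0)) * (r - r0).
  rewrite ler_wpM2l ?lerB // subr_ge0 ler_expR; lra.
lra.
Qed.

Lemma Re_le_cmod (z : C) : complex.Re z <= cmod z.
Proof.
case: z => a b; rewrite /cmod /=; apply: le_trans (ler_norm a) _.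
by rewrite -sqrtr_sqr ler_wsqrtr // lerDl sqr_ge0.
Qed.

Lemma cmod_ge0 (z : C) : 0 <= cmod z.
Proof. by case: z => a b; rewrite /cmod /= sqrtr_ge0. Qed.

Lemma grad_normZ (c : R) (f : cube n -> C) x :
  grad_norm (fun y => c%:C * f y) x ^+ 2 = c ^+ 2 * grad_norm f x ^+ 2.
Proof.
rewrite /grad_norm !sqr_sqrtr ?mulr_sumr; try by
  apply: sumr_ge0 => j _; exact: sqr_ge0.
apply: eq_bigr => j _; rewrite /cube_partial -mulrBr cmodM cmodR exprMn.
by rewrite real_normK ?num_real.
Qed.

Lemma fourier_multiplierZ (c : R) h (f : cube n -> C) x :
  fourier_multiplier h (fun y => c%:C * f y) x = c%:C * fourier_multiplier h f x.
Proof.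
rewrite /fourier_multiplier mulr_sumr; apply: eq_bigr => A _.
have -> : fourier_coef (fun y => c%:C * f y) A = c%:C * fourier_coef f A.
  rewrite /fourier_coef /mean mulrA mulr_sumr; congr (_ / _).
  by apply: eq_bigr => y _; rewrite mulrA.
by rewrite -!mulrA mulrCA.
Qed.

Lemma rot_weight_angle (t : R) (k : nat) :
  rot_weight (cos (t / 2)) (sin (t / 2)) k = k%:R * (sin t * cos t ^+ k.-1).
Proof.
rewrite /rot_weight; congr (_ * (_ * _ ^+ _)).
  by rewrite [in RHS](splitr t) sinD; ring.
by rewrite [in RHS](splitr t) cosD; ring.
Qed.

(** Jensen's inequality for the probability w / K and the convex function
    2 cosh, in tangent form.  With r0 x the modulus of the target at x, summing
    the tangent inequalities over x gives an inequality that is affine in the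
    multipliers k sin t (cos t)^(k-1) and holds for every angle t; integrating
    it against w needs only the integrals of these finitely many functions. *)
Lemma mean_exp_multiplier_le (D : set (measurableTypeR R)) (w : R -> R)
    (K : R) (p : nat -> R) (f : cube n -> C) :
  measurable D -> 0 < K -> (forall t, D t -> 0 <= w t) -> has_integral D w K ->
  (forall k, has_integral D
     (fun t => w t * (k%:R * (sin t * cos t ^+ k.-1))) (p k)) ->
  mean (fun x => expR (cmod (fourier_multiplier p f x)))
  <= 2 * mean (fun x => expR (K ^+ 2 / 8 * grad_norm f x ^+ 2)).
Proof.
move=> mD K0 w0 iw ip.
set B := \sum_x expR (K ^+ 2 / 8 * grad_norm f x ^+ 2).
pose r0 x := cmod (fourier_multiplier p f x).
have [ph hph] := boolp.choice (fun x => complex_phase (fourier_multiplier p f x)).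
pose d x := expR (r0 x) - expR (- r0 x).
(* The affine form: constant term a, coefficient b A of the multiplier at A. *)
pose a := \sum_x (expR (r0 x) + expR (- r0 x) - d x * r0 x).
pose q x (A : {set 'I_n}) :=
  complex.Re (fourier_coef f A * walsh C A x * ((ph x)^*)%R).
pose b (A : {set 'I_n}) := \sum_x d x * K * q x A.
have Reflow h x : complex.Re (fourier_multiplier h f x * ((ph x)^*)%R) =
    \sum_(A : {set 'I_n}) h #|A| * q x A.
  rewrite /fourier_multiplier mulr_suml Re_sum; apply: eq_bigr => A _.
  by rewrite /q -!mulrA Re_realM.
have lin h : a + \sum_(A : {set 'I_n}) b A * h #|A| =
    \sum_x (expR (r0 x) + expR (- r0 x)
       + d x * (K * complex.Re (fourier_multiplier h f x * ((ph x)^*)%R) - r0 x)).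
  have -> : \sum_(A : {set 'I_n}) b A * h #|A|
      = \sum_x \sum_(A : {set 'I_n}) d x * K * q x A * h #|A|.
    by rewrite exchange_big; apply: eq_bigr => A _; rewrite mulr_suml.
  rewrite -big_split; apply: eq_bigr => x _ /=.
  rewrite Reflow.
  have -> : \sum_(A : {set 'I_n}) d x * K * q x A * h #|A|
      = d x * (K * \sum_(A : {set 'I_n}) h #|A| * q x A).
    by rewrite !mulr_sumr; apply: eq_bigr => A _; ring.
  ring.
have ptw t : a + \sum_(A : {set 'I_n})
    b A * (#|A|%:R * (sin t * cos t ^+ #|A|.-1)) <= 2 * B.
  rewrite (lin (fun k => k%:R * (sin t * cos t ^+ k.-1))).
  have cs1 : cos (t / 2) ^+ 2 + sin (t / 2) ^+ 2 = 1 by exact: cos2Dsin2.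
  have := sum_exp_rotation_le _ _ (fun y => K%:C * f y) cs1.
  under [X in _ <= _ * X]eq_bigr do rewrite grad_normZ mulrAC.
  apply: le_trans; apply: ler_sum => x _.
  rewrite fourier_multiplierZ cmodM cmodR gtr0_norm //.
  apply: cosh_tangent; first exact: cmod_ge0.
  rewrite ler_pM2l //.
  have -> : rot_weight (cos (t / 2)) (sin (t / 2))
      = (fun k => k%:R * (sin t * cos t ^+ k.-1)).
    by apply/funext => k; exact: rot_weight_angle.
  apply: le_trans (Re_le_cmod _) _; rewrite cmodM.
  suff -> : cmod ((ph x)^*)%R = 1 by rewrite mulr1.
  have [+ _] := hph x; rewrite mulr_conj_cmod => -[] h.
  have : cmod (ph x) = 1.
    by apply/eqP; rewrite -(@pexpr_eq1 _ _ 2) ?cmod_ge0 //; apply/eqP.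
  by case: (ph x) => u v; rewrite /cmod /= sqrrN.
have int : a * K + \sum_(A : {set 'I_n}) b A * p #|A| <= 2 * B * K.
  have i1 := has_integral_sum _ _ _ _ mD
    (fun A : {set 'I_n} => has_integralZ _ _ _ (b A) mD (ip #|A|)).
  have i2 := has_integralD _ _ _ _ _ mD (has_integralZ _ _ _ a mD iw) i1.
  apply: has_integral_le mD i2 (has_integralZ _ _ _ (2 * B) mD iw) _ => t Dt /=.
  apply: le_trans (ler_wpM2r (w0 t Dt) (ptw t)).
  rewrite mulrDl lerD2l mulr_suml le_eqVlt; apply/orP; left; apply/eqP.
  by apply: eq_bigr => A _; rewrite mulrCA mulrC.
have : K * \sum_x (expR (r0 x) + expR (- r0 x)) <= K * (2 * B).
  rewrite [leRHS]mulrC; apply: le_trans int.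
  have aE : a = \sum_x (expR (r0 x) + expR (- r0 x)) - \sum_x d x * r0 x.
    by rewrite -sumrB.
  have bE : \sum_(A : {set 'I_n}) b A * p #|A| = K * \sum_x d x * r0 x.
    apply: (addrI a); rewrite lin [in RHS]aE mulr_sumr -sumrB -big_split /=.
    apply: eq_bigr => x _; have [_ ->] := hph x.
    by rewrite /= -/(r0 x); ring.
  by rewrite bE aE mulrBl mulrC (mulrC K (\sum_x _ * _)) subrK.
rewrite ler_pM2l // => H.
rewrite /mean -/B mulrA ler_wpM2r ?invr_ge0 ?ler0n //.
apply: le_trans H; apply: ler_sum => x _; by rewrite lerDl expR_ge0.
Qed.
End Jensen.

(** * Integrals over open intervals *)
Section OpenInterval.
Context {R : realType}.
Local Notation mu := (@lebesgue_measure R).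
Implicit Types (a b x : R) (F G : R -> R).

(** An increasing sequence of segments that exhausts the open interval.  The
    first one is reduced to the midpoint. *)
Definition inner_itv a b (m : nat) : interval R :=
  `[a + (b - a) / 2 * m.+1%:R^-1, b - (b - a) / 2 * m.+1%:R^-1].

Lemma inner_itv_le a b m : a < b ->
  a + (b - a) / 2 * m.+1%:R^-1 <= b - (b - a) / 2 * m.+1%:R^-1.
Proof.
move=> ab; have h1 : m.+1%:R^-1 <= 1 :> R by rewrite invf_le1 ?ler1n ?ltr0n.
have := ler_wpM2l (_ : 0 <= (b - a)) h1; rewrite subr_ge0 (ltW ab) => /(_ erefl).
by move: (m.+1%:R^-1) => t h; lra.
Qed.

Lemma inner_itv_sub a b m x : a < b -> x \in inner_itv a b m -> a < x < b.
Proof.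
move=> ab; rewrite in_itv /= => /andP[h1 h2].
have : 0 < (b - a) / 2 * m.+1%:R^-1.
  by rewrite mulr_gt0 ?divr_gt0 ?subr_gt0 ?invr_gt0.
by move: (_ * _) h1 h2 => t h1 h2 t0; apply/andP; split; lra.
Qed.

Lemma inner_itv_nd a b : a < b ->
  nondecreasing_seq (fun m => [set` inner_itv a b m] : set R).
Proof.
move=> ab m k mk; rewrite subsetEset => x /=; rewrite !in_itv /=.
have : (b - a) / 2 * k.+1%:R^-1 <= (b - a) / 2 * m.+1%:R^-1.
  by rewrite ler_wpM2l ?divr_ge0 ?subr_ge0 ?(ltW ab) // lef_pV2 ?posrE ?ltr0n
    // ler_nat.
move: (_ * _) (_ * _) => s t st /andP[h1 h2]; apply/andP; split; lra.
Qed.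

Lemma inner_itv_bigcup a b : a < b ->
  \bigcup_m [set` inner_itv a b m] = `]a, b[%classic.
Proof.
move=> ab; apply/seteqP; split => x /=.
  by move=> [m _ /=] /(inner_itv_sub _ _ _ _ ab); rewrite in_itv.
rewrite in_itv /= => /andP[ax xb].
pose e := Num.min (x - a) (b - x) / (b - a).
have e0 : 0 < e by rewrite divr_gt0 ?lt_min ?subr_gt0 // ax.
have [m _ /(_ m (leqnn m)) hm] := near_infty_natSinv_lt (PosNum e0).
exists m => //=; rewrite in_itv /=.
move: hm; rewrite /= ltr_pdivlMr ?subr_gt0 // lt_min => /andP[h1 h2].
have : 0 < m.+1%:R^-1 :> R by rewrite invr_gt0.
move: (m.+1%:R^-1) h1 h2 => t h1 h2 t0; apply/andP; split; nra.
Qed.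

Lemma ge0_integral_inner_itv_cvg a b G : a < b ->
  (forall x, a < x < b -> {for x, continuous G}) ->
  (forall x, a < x < b -> 0 <= G x) ->
  (\int[mu]_(x in [set` inner_itv a b m]) (G x)%:E)%E @[m --> \oo] -->
  (\int[mu]_(x in `]a, b[) (G x)%:E)%E.
Proof.
move=> ab cG G0; rewrite -inner_itv_bigcup //.
apply: ge0_nondecreasing_set_cvg_integral; first exact: inner_itv_nd.
- by move=> m; exact: measurable_itv.
- move=> m; apply/measurable_EFinP; apply: subspace_continuous_measurable_fun.
    exact: measurable_itv.
  apply: continuous_in_subspaceT => x; rewrite inE /= => xm.
  by apply: cG; exact: inner_itv_sub xm.
- by move=> m x /= xm; rewrite lee_fin G0 //; exact: inner_itv_sub xm.
Qed.

End OpenInterval.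

Section Substitution.
Context {R : realType}.
Local Notation mu := (@lebesgue_measure R).
Implicit Types (a b x : R) (F G f : R -> R).

Lemma derive1_near F f a b x : a < x < b ->
  (forall x, a < x < b -> is_derive x 1 F (f x)) -> {near x, (derive1 F) =1 f}.
Proof.
move=> axb dF; have xab : x \in `]a, b[ by rewrite in_itv.
apply: filterS (near_in_itvoo xab) => y; rewrite in_itv /= => /dF [_ <-].
by rewrite derive1E.
Qed.

Lemma derive1_cvg F f a b x : a < x < b ->
  (forall x, a < x < b -> is_derive x 1 F (f x)) ->
  {for x, continuous f} -> derive1 F y @[y --> x] --> (derive1 F) x.
Proof.
move=> axb dF cf; rewrite derive1E; have [_ ->] := dF x axb.
apply: cvg_trans cf; apply: near_eq_cvg.
by apply: filterS (derive1_near _ _ _ _ _ axb dF) => y ->.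
Qed.

Lemma derivable_inner_itv F f a b c d : a < c -> d < b ->
  (forall x, a < x < b -> is_derive x 1 F (f x)) -> c <= d ->
  derivable_oo_LRcontinuous F c d.
Proof.
move=> ac db dF cd.
have cF x : a < x < b -> F y @[y --> x] --> F x.
  by move=> /dF [dx _]; exact/differentiable_continuous/derivable1_diffP.
split; [|apply: cvg_at_right_filter|apply: cvg_at_left_filter].
- move=> x; rewrite in_itv /= => /andP[cx xd].
  by have [] := dF x; rewrite ?(lt_trans ac cx) ?(lt_trans xd db).
- by apply: cF; rewrite ac (le_lt_trans cd db).
- by apply: cF; rewrite db (lt_le_trans ac cd).
Qed.

(** Neither G nor the derivative f of F is required to have limits at the ends of
    the intervals: the substitution is made on the segments of the exhaustion
    and on their images, and both sides pass to the limit by monotone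
    convergence. *)
Lemma ge0_substitution_oo F f G a b : a < b ->
  (forall x, a < x < b -> is_derive x 1 F (f x)) ->
  (forall x, a < x < b -> {for x, continuous f}) ->
  (forall x, a < x < b -> 0 <= f x) ->
  (forall x y, a < x < b -> a < y < b -> x < y -> F x < F y) ->
  (forall x, a < x < b -> 0 < F x) ->
  (forall y, 0 < y -> exists2 x, a < x < b & F x = y) ->
  (forall y, 0 < y -> {for y, continuous G}) ->
  (forall y, 0 < y -> 0 <= G y) ->
  (\int[mu]_(y in `]0%R, +oo[) (G y)%:E =
   \int[mu]_(x in `]a, b[) (G (F x) * f x)%:E)%E.
Proof.
move=> ab dF cf f0 incrF F0 surjF cG G0.
pose lo m := a + (b - a) / 2 * m.+1%:R^-1.
pose hi m := b - (b - a) / 2 * m.+1%:R^-1.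
have lohi m : lo m <= hi m by exact: inner_itv_le.
have inab m x : lo m <= x <= hi m -> a < x < b.
  by move=> h; apply: (inner_itv_sub a b m) => //; rewrite in_itv.
have lom m : a < lo m < b by apply: (inab m); rewrite lexx lohi.
have him m : a < hi m < b by apply: (inab m); rewrite lexx lohi.
have Fcont x : a < x < b -> {for x, continuous F}.
  by move=> /dF [dx _]; exact/differentiable_continuous/derivable1_diffP.
have wincrF x y : a < x < b -> a < y < b -> x <= y -> F x <= F y.
  move=> xab yab; rewrite le_eqVlt => /predU1P[->//|xy]; exact/ltW/incrF.
have step m : (\int[mu]_(y in `[F (lo m), F (hi m)]) (G y)%:E =
    \int[mu]_(x in [set` inner_itv a b m]) (G (F x) * f x)%:E)%E.
  rewrite integration_by_substitution_increasing //.
  - apply: eq_integral => x; rewrite inE /= in_itv /= => /inab xab.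
    by rewrite fctE derive1E; have [_ ->] := dF x xab.
  - move=> x y; rewrite !in_itv /= => /inab xab /inab yab; exact: incrF.
  - move=> x; rewrite in_itv /= => /andP[h1 h2].
    have xab : a < x < b by apply: (inab m); rewrite !ltW.
    exact: derive1_cvg xab dF (cf x xab).
  - apply/cvg_ex; exists ((derive1 F) (lo m)); apply: cvg_at_right_filter.
    exact: derive1_cvg (lom m) dF (cf _ (lom m)).
  - apply/cvg_ex; exists ((derive1 F) (hi m)); apply: cvg_at_left_filter.
    exact: derive1_cvg (him m) dF (cf _ (him m)).
  - apply: derivable_inner_itv dF (lohi m).
      by have /andP[] := lom m.
    by have /andP[] := him m.
  - apply: continuous_in_subspaceT => y; rewrite inE /= in_itv /= => /andP[h _].
    by apply: cG; exact: lt_le_trans (F0 _ (lom m)) h.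
have cv1 := ge0_integral_inner_itv_cvg a b (fun x => G (F x) * f x) ab _ _.
have cv2 : (\int[mu]_(y in `[F (lo m), F (hi m)]) (G y)%:E)%E @[m --> \oo] -->
    (\int[mu]_(y in `]0%R, +oo[) (G y)%:E)%E.
  have -> : `]0, +oo[%classic = \bigcup_m `[F (lo m), F (hi m)]%classic :> set R.
    apply/seteqP; split => y /=.
      rewrite in_itv /= andbT => /surjF [x xab <-].
      have : [set` `]a, b[] x by rewrite /= in_itv.
      rewrite -inner_itv_bigcup // => -[m _ xm]; exists m => //=.
      have := xm; rewrite /= !in_itv /= -/(lo m) -/(hi m) => /andP[h1 h2].
      by rewrite !wincrF.
    move=> [m _ /=]; rewrite !in_itv /= andbT => /andP[h _].
    exact: lt_le_trans (F0 _ (lom m)) h.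
  apply: ge0_nondecreasing_set_cvg_integral.
  - move=> m k mk; rewrite subsetEset => y /=; rewrite !in_itv /=.
    have sub x : lo m <= x <= hi m -> lo k <= x <= hi k.
      have := inner_itv_nd a b ab m k mk; rewrite subsetEset => /(_ x) /=.
      by rewrite !in_itv.
    have /andP[h1 _] := sub (lo m) (introT andP (conj (lexx _) (lohi m))).
    have /andP[_ h2] := sub (hi m) (introT andP (conj (lohi m) (lexx _))).
    move=> /andP[h3 h4]; rewrite (le_trans _ h3) ?wincrF //.
    by rewrite (le_trans h4) ?wincrF.
  - by move=> m; exact: measurable_itv.
  - move=> m; apply/measurable_EFinP; apply: subspace_continuous_measurable_fun.
      exact: measurable_itv.
    apply: continuous_in_subspaceT => y; rewrite inE /= in_itv /= => /andP[h _].
    by apply: cG; exact: lt_le_trans (F0 _ (lom m)) h.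
  - move=> m y /=; rewrite in_itv /= => /andP[h _]; rewrite lee_fin G0 //.
    exact: lt_le_trans (F0 _ (lom m)) h.
rewrite (_ : (fun m => _) = fun m =>
    (\int[mu]_(x in [set` inner_itv a b m]) (G (F x) * f x)%:E)%E) in cv2; last first.
  by apply/funext => m; exact: step.
apply: (cvg_unique _ cv2 (cv1 _ _)); first exact: ereal_hausdorff.
  move=> x xab; apply: continuousM; last exact: cf.
  apply: continuous_comp; first exact: Fcont.
  exact/cG/F0.
by move=> x xab; rewrite mulr_ge0 ?G0 ?F0 ?f0.
Qed.

End Substitution.

(** * The weights 1 and (- ln cos)^(-alpha) on ]0, pi/2[ *)
Section Weights.
Context {R : realType}.
Local Notation mu := (@lebesgue_measure R).
Implicit Types (a b x t : R) (F f : R -> R).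

Lemma has_integral_derive F f a b : a < b ->
  (forall x, is_derive x 1 F (f x)) -> continuous f ->
  has_integral `]a, b[%classic f (F b - F a).
Proof.
move=> ab dF cf.
have cF x : {for x, continuous F}.
  by have [dx _] := dF x; exact/differentiable_continuous/derivable1_diffP.
have wcf : {within `[a, b], continuous f} by exact: continuous_subspaceT.
have icc : mu.-integrable `[a, b] (EFin \o f).
  by apply: continuous_compact_integrable => //; exact: segment_compact.
have ioo : mu.-integrable `]a, b[ (EFin \o f).
  by apply: integrableS icc => //; exact: subset_itv_oo_cc.
split => //; rewrite /Rintegral.
rewrite -(@integral_itv_bndoo _ _ _ (EFin \o f) true false); last first.
  by case/integrableP: ioo.
rewrite -[RHS]/(fine ((F b)%:E - (F a)%:E)%E); congr fine.
apply: (continuous_FTC2 ab wcf) => //.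
  split; [by move=> x _; have [] := dF x|apply: cvg_at_right_filter|
    apply: cvg_at_left_filter]; exact: cF.
by move=> x _; rewrite derive1E; have [_ ->] := dF x.
Qed.

(** The primitive is - cos^k. *)
Lemma has_integral_sin_cosX (k : nat) :
  has_integral `]0, (pi / 2)[%classic
    (fun t : R => k%:R * (sin t * cos t ^+ k.-1)) (0 < k)%:R.
Proof.
have -> : (0 < k)%:R = - cos (pi / 2) ^+ k - - cos 0 ^+ k :> R.
  rewrite cos_pihalf cos0 expr1n opprK; case: k => [|k].
    by rewrite expr0 addNr.
  by rewrite expr0n oppr0 add0r.
apply: (@has_integral_derive (fun t => - cos t ^+ k)).
- by rewrite divr_gt0 ?pi_gt0.
- move=> x; have -> : (fun t : R => - cos t ^+ k) = - (cos ^+ k).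
    by apply/funext => t; rewrite fctE exprfctE.
  apply: is_derive_eq; rewrite /GRing.scale /=; ring.
- move=> x; apply: cvgM; first exact: cvg_cst.
  apply: cvgM; first exact: continuous_sin.
  apply: (@continuous_comp _ _ _ cos (fun c : R => c ^+ k.-1)).
    exact: continuous_cos.
  exact: exprn_continuous.
Qed.

Lemma has_integral1_pihalf :
  has_integral `]0, (pi / 2)[%classic (fun=> 1 : R) (pi / 2).
Proof.
have := @has_integral_derive id (fun=> 1) 0 (pi / 2); rewrite subr0; apply.
- by rewrite divr_gt0 ?pi_gt0.
- by move=> x; exact: cvg_cst.
Qed.

Section LogCos.
Variable alpha : R.
Hypotheses (alpha_gt0 : 0 < alpha) (alpha_lt : alpha < 1 / 2).
Local Notation D := (`]0, (pi / 2)[%classic : set (measurableTypeR R)).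

Definition logcos_weight t : R := (- ln (cos t)) `^ (- alpha).

Lemma cos_oo t : 0 < t < pi / 2 -> 0 < cos t < 1.
Proof.
move=> /andP[t0 t1]; have c0 : 0 < cos t.
  by apply: cos_gt0_pihalf; rewrite t1 andbT; lra.
rewrite c0 /= lt_neqAle cos_le1 andbT; apply/eqP => c1.
have s0 : 0 < sin t by apply: sin_gt0_pihalf; rewrite t0.
by have := cos2Dsin2 t; rewrite c1 expr1n; nra.
Qed.

Lemma sin_oo t : 0 < t < pi / 2 -> 0 < sin t <= 1.
Proof. by move=> t0; rewrite sin_gt0_pihalf // sin_le1. Qed.

Lemma log_cos_bounds t : 0 < t < pi / 2 ->
  [&& 0 < 1 - cos t, 1 - cos t <= - ln (cos t) & - ln (cos t) <= (cos t)^-1].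
Proof.
move=> /cos_oo/andP[c0 c1].
apply/and3P; split; first by rewrite subr_gt0.
  have H : -1 < cos t - 1 by lra.
  by have := le_ln1Dx H; rewrite addrC subrK; lra.
rewrite -lnV ?posrE //; apply/ltW/ln_sublinear; by rewrite invr_gt0.
Qed.

Lemma is_derive_log_cos t : 0 < t < pi / 2 ->
  is_derive t 1 (fun t => - ln (cos t)) (sin t / cos t).
Proof.
move=> /cos_oo/andP[c0 _].
have h : is_derive t 1 (@ln R \o cos) ((cos t)^-1 * - sin t).
  by apply: is_derive1_comp; exact: is_derive1_ln.
apply: (@is_derive_eq _ _ _ (- (@ln R \o cos))).
by rewrite mulrN opprK mulrC.
Qed.

Lemma logcos_weight_continuous t : 0 < t < pi / 2 ->
  {for t, continuous logcos_weight}.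
Proof.
move=> t0; have /and3P[h1 h2 _] := log_cos_bounds t t0.
have [dl _] := is_derive_log_cos t t0.
apply: (@continuous_comp _ _ _ (fun t => - ln (cos t))
  (fun y : R => y `^ (- alpha))).
  exact/differentiable_continuous/derivable1_diffP.
have [dp _] := is_derive1_powR (- alpha) (lt_le_trans h1 h2).
exact/differentiable_continuous/derivable1_diffP.
Qed.

Lemma logcos_weight_ge0 t : 0 <= logcos_weight t.
Proof. exact: powR_ge0. Qed.

(** A primitive of an integrable majorant of the weight: cos_power is bounded by
    (1/2 - alpha)^-1 on ]0, pi/2[, which is where alpha < 1/2 enters. *)
Definition cos_power t : R := (2^-1 - alpha)^-1 * (1 - cos t) `^ (2^-1 - alpha).
Definition cos_power' t : R := (1 - cos t) `^ (2^-1 - alpha - 1) * sin t.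

Lemma is_derive_cos_power t : 0 < t < pi / 2 ->
  is_derive t 1 cos_power (cos_power' t).
Proof.
move=> t0; have /and3P[h1 h2 _] := log_cos_bounds t t0.
have dp := is_derive1_powR (2^-1 - alpha) h1.
have h : is_derive t 1 ((@powR R ^~ (2^-1 - alpha)) \o (fun t => 1 - cos t))
   ((2^-1 - alpha) * (1 - cos t) `^ (2^-1 - alpha - 1) * sin t).
  apply: is_derive1_comp.
  by apply: is_derive_eq; rewrite opprK add0r mul1r.
rewrite /cos_power.
have ne : 2^-1 - alpha != 0 by rewrite gt_eqF // subr_gt0 -[2^-1]mul1r.
apply: (is_derive_eq (is_deriveZ (2^-1 - alpha)^-1 h)).
by rewrite /GRing.scale /= -mulrA mulKf.
Qed.

(** From - ln c >= 1 - c with a negative exponent, and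
    sin t >= (1 - cos t)^(1/2), as 1 - c <= 1 - c^2 for 0 <= c <= 1. *)
Lemma logcos_weight_le t : 0 < t < pi / 2 -> logcos_weight t <= cos_power' t.
Proof.
move=> t0; have /and3P[h1 h2 _] := log_cos_bounds t t0.
have /andP[c0 c1] := cos_oo t t0; have /andP[s0 _] := sin_oo t t0.
apply: (@le_trans _ _ ((1 - cos t) `^ (- alpha))).
  rewrite /logcos_weight !powRN lef_pV2 ?posrE ?powR_gt0 //; last first.
    exact: lt_le_trans h1 h2.
  by apply: ge0_ler_powR; rewrite ?nnegrE ?(ltW alpha_gt0) ?(ltW h1) //
    ltW // (lt_le_trans h1 h2).
rewrite /cos_power'.
have -> : 2^-1 - alpha - 1 = - alpha + - 2^-1 by lra.
rewrite powRD; last by rewrite (gt_eqF h1) implybT.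
rewrite -mulrA ler_peMr ?powR_ge0 // powRN powR12_sqrt ?(ltW h1) //.
rewrite mulrC ler_pdivlMr ?sqrtr_gt0 // mul1r.
rewrite -(ger0_norm (ltW s0)) -sqrtr_sqr ler_wsqrtr //.
have := cos2Dsin2 t; nra.
Qed.

Lemma integrable_logcos_weight : mu.-integrable D (EFin \o logcos_weight).
Proof.
have ab : 0 < pi / 2 :> R by rewrite divr_gt0 ?pi_gt0.
have mw : measurable_fun D (EFin \o logcos_weight).
  apply/measurable_EFinP; apply: open_continuous_measurable_fun.
    exact: interval_open.
  move=> t; rewrite inE /= in_itv /= => t0.
  exact: logcos_weight_continuous.
apply/integrableP; split=> //.
have -> : (\int[mu]_(t in D) `|(EFin \o logcos_weight) t|
    = \int[mu]_(t in D) (logcos_weight t)%:E)%E.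
  by apply: eq_integral => t _; rewrite /= ger0_norm // logcos_weight_ge0.
apply: (@le_lt_trans _ _ (2^-1 - alpha)^-1%:E); last exact: ltry.
have cv := ge0_integral_inner_itv_cvg 0 (pi / 2) logcos_weight ab
  logcos_weight_continuous (fun t _ => logcos_weight_ge0 t).
rewrite -(cvg_lim _ cv) //; apply: lime_le.
  by apply/cvg_ex; eexists; exact: cv.
apply: nearW => m; rewrite /inner_itv.
set lo : R := 0 + _; set hi : R := pi / 2 - _.
have lohi : lo <= hi by exact: inner_itv_le.
have inD x : lo <= x <= hi -> 0 < x < pi / 2.
  by move=> h; apply: (inner_itv_sub 0 (pi / 2) m) => //; rewrite in_itv.
have lo0 : 0 < lo < pi / 2 by apply: inD; rewrite lexx.
have hi0 : 0 < hi < pi / 2 by apply: inD; rewrite lexx lohi.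
move: lohi; rewrite le_eqVlt => /predU1P[->|lohi].
  rewrite set_itv1 integral_set1 lee_fin invr_ge0 subr_ge0 -[2^-1]mul1r.
  exact: ltW.
have cont (g : R -> R) : (forall t, 0 < t < pi / 2 -> {for t, continuous g}) ->
    {within `[lo, hi], continuous g}.
  move=> cg; apply: continuous_in_subspaceT => t; rewrite inE /= in_itv /=.
  by move=> /inD; exact: cg.
have icc (g : R -> R) : (forall t, 0 < t < pi / 2 -> {for t, continuous g}) ->
    measurable_fun `[lo, hi] (EFin \o g).
  move=> cg; apply/measurable_EFinP; apply: subspace_continuous_measurable_fun.
    exact: measurable_itv.
  exact: cont.
have cg t : 0 < t < pi / 2 -> {for t, continuous cos_power'}.
  move=> t0; have /and3P[h1 h2 _] := log_cos_bounds t t0.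
  apply: continuousM; last exact: continuous_sin.
  apply: (@continuous_comp _ _ _ (fun t => 1 - cos t)
    (fun y : R => y `^ (2^-1 - alpha - 1))).
    by apply: cvgB; [exact: cvg_cst|exact: continuous_cos].
  have [dp _] := is_derive1_powR (2^-1 - alpha - 1) h1.
  exact/differentiable_continuous/derivable1_diffP.
apply: (@le_trans _ _ (\int[mu]_(t in `[lo, hi]) (cos_power' t)%:E)%E).
  apply: ge0_le_integral => //.
  - by move=> t _; rewrite lee_fin logcos_weight_ge0.
  - apply: icc => t; exact: logcos_weight_continuous.
  - exact: icc.
  - by move=> t /=; rewrite in_itv /= => /inD t0; rewrite lee_fin logcos_weight_le.
rewrite (continuous_FTC2 lohi (cont _ cg) (F := cos_power)).
- rewrite lee_fin.
  have a0 : 0 < (2^-1 - alpha)^-1 by rewrite invr_gt0 subr_gt0 -[2^-1]mul1r.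
  rewrite /cos_power -mulrBr ler_piMr ?(ltW a0) // lerBlDr.
  apply: (@le_trans _ _ 1); last by rewrite lerDl powR_ge0.
  have /and3P[h1 _ _] := log_cos_bounds hi hi0.
  have /andP[c0 _] := cos_oo hi hi0.
  have g0 : 0 <= 2^-1 - alpha by rewrite subr_ge0 -[2^-1]mul1r ltW.
  have le1 : 1 - cos hi <= 1 by rewrite lerBlDr lerDl ltW.
  have := ge0_ler_powR g0 _ _ le1; rewrite powR1; apply.
    by rewrite nnegrE ltW.
  by rewrite nnegrE.
- have /andP[l0 _] := lo0; have /andP[_ hh] := hi0.
  exact: derivable_inner_itv l0 hh is_derive_cos_power (ltW lohi).
- move=> t; rewrite in_itv /= => /andP[h1 h2].
  have t0 : 0 < t < pi / 2 by apply: inD; rewrite !ltW.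
  by rewrite derive1E; have [_ ->] := is_derive_cos_power t t0.
Qed.

End LogCos.
End Weights.

Section GammaLogCos.
Context {R : realType}.
Variable alpha : R.
Hypotheses (alpha_gt0 : 0 < alpha) (alpha_lt : alpha < 1 / 2).
Local Notation mu := (@lebesgue_measure R).
Local Notation D := (`]0, (pi / 2)[%classic : set (measurableTypeR R)).
Local Notation w := (logcos_weight alpha).

Lemma integrable_logcos_sin_cosX (k : nat) :
  mu.-integrable D (EFin \o (fun t => w t * (k%:R * (sin t * cos t ^+ k.-1)))).
Proof.
have mD : measurable D by exact: measurable_itv.
have iw := integrable_logcos_weight alpha alpha_gt0 alpha_lt.
apply: (le_integrable mD _ _ (integrableZl mD k%:R iw)).
  apply/measurable_EFinP; apply: open_continuous_measurable_fun.
    exact: interval_open.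
  move=> t; rewrite inE /= in_itv /= => t0.
  apply: continuousM; first exact: logcos_weight_continuous.
  apply: cvgM; first exact: cvg_cst.
  apply: cvgM; first exact: continuous_sin.
  apply: (@continuous_comp _ _ _ cos (fun c : R => c ^+ k.-1)).
    exact: continuous_cos.
  exact: exprn_continuous.
move=> t /=; rewrite in_itv /= => t0; rewrite lee_fin.
have /andP[s0 s1] := sin_oo t t0; have /andP[c0 c1] := cos_oo t t0.
have c2 : 0 <= sin t * cos t ^+ k.-1 <= 1.
  rewrite mulr_ge0 ?exprn_ge0 ?(ltW s0) ?(ltW c0) //=.
  by rewrite mulr_ile1 ?exprn_ge0 ?exprn_ile1 ?(ltW s0) ?(ltW c0) ?(ltW c1).
have w0 := logcos_weight_ge0 alpha t.
have /andP[c3 c4] := c2.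
rewrite ger0_norm; last by rewrite mulr_ge0 // mulr_ge0 ?ler0n.
rewrite ger0_norm; last by rewrite mulr_ge0 ?ler0n.
by rewrite mulrCA ler_wpM2l ?ler0n // ler_piMr.
Qed.

(** The substitution y = - k ln(cos t), with dy = k tan t dt and
    e^(-y) = (cos t)^k. *)
Lemma ge0_integral_Gamma_logcos (k : nat) : (0 < k)%N ->
  (\int[mu]_(y in `]0%R, +oo[) (y `^ (1 - alpha - 1) * expR (- y))%:E =
   \int[mu]_(t in D)
     (k%:R `^ (- alpha) * (w t * (k%:R * (sin t * cos t ^+ k.-1))))%:E)%E.
Proof.
move=> k0; have k0' : 0 < k%:R :> R by rewrite ltr0n.
have inpi (z : R) : 0 < z < pi / 2 -> z \in `[0, pi].
  rewrite in_itv /= => /andP[z0 z1]; rewrite (ltW z0) /=.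
  by have := pi_gt0 R; lra.
have ab : 0 < pi / 2 :> R by rewrite divr_gt0 ?pi_gt0.
have dF (t : R) : 0 < t < pi / 2 ->
    is_derive t 1 (fun t : R => k%:R * - ln (cos t)) (k%:R * (sin t / cos t)).
  by move=> t0; exact: (is_deriveZ k%:R (is_derive_log_cos t t0)).
rewrite (ge0_substitution_oo (fun t => k%:R * - ln (cos t))
  (fun t => k%:R * (sin t / cos t)) _ 0 (pi / 2) ab dF).
- apply: eq_integral => t; rewrite inE /= in_itv /= => t0; congr EFin.
  have /andP[c0 _] := cos_oo t t0.
  have /and3P[l0 l1 _] := log_cos_bounds t t0.
  rewrite addrAC subrr sub0r powRM ?ler0n ?(le_trans (ltW l0) l1) //.
  rewrite -mulrN opprK expRM_natl lnK ?posrE // -/(w t).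
  have -> : cos t ^+ k = cos t * cos t ^+ k.-1 by rewrite -exprS prednK.
  by field; rewrite gt_eqF.
- move=> t t0; have /andP[c0 _] := cos_oo t t0.
  apply: cvgM; first exact: cvg_cst.
  apply: cvgM; first exact: continuous_sin.
  by apply: cvgV; [rewrite gt_eqF|exact: continuous_cos].
- move=> t t0; have /andP[c0 _] := cos_oo t t0; have /andP[s0 _] := sin_oo t t0.
  by rewrite mulr_ge0 ?ler0n // divr_ge0 ?ltW.
- move=> x y xD yD xy; rewrite ltr_pM2l // ltrN2.
  have /andP[cx _] := cos_oo x xD; have /andP[cy _] := cos_oo y yD.
  by rewrite ltr_ln ?posrE // ltr_cos // inpi.
- move=> t t0; have /and3P[l0 l1 _] := log_cos_bounds t t0.
  by rewrite mulr_gt0 // (lt_le_trans l0 l1).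
- move=> y y0; pose u := expR (- (y / k%:R)).
  have u0 : 0 < u by exact: expR_gt0.
  have u1 : u < 1 by rewrite expR_lt1 oppr_lt0 divr_gt0.
  have uI : -1 <= u <= 1 by apply/andP; split; lra.
  have cu : cos (acos u) = u by rewrite acosK // in_itv.
  exists (acos u); last by rewrite cu /u expRK opprK mulrC divfK ?gt_eqF.
  rewrite acos_gt0 ?u1 ?andbT //=; last by lra.
  rewrite -ltr_cos ?cos_pihalf ?cu // in_itv /=.
    by rewrite acos_ge0 ?acos_lepi.
  by have := pi_gt0 R; move=> p0; apply/andP; split; lra.
- move=> y y0.
  apply: (@continuousM _ _ (fun y : R => y `^ (1 - alpha - 1))
    (fun y : R => expR (- y))).
    have [dp _] := is_derive1_powR (1 - alpha - 1) y0.
    exact/differentiable_continuous/derivable1_diffP.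
  apply: (@continuous_comp _ _ _ (fun y : R => - y) (@expR R)).
    exact: continuousN.
  exact: continuous_expR.
- by move=> y y0; rewrite mulr_ge0 ?powR_ge0 ?expR_ge0.
Qed.

Lemma Gamma_logcos (k : nat) : (0 < k)%N ->
  Gamma (1 - alpha) = k%:R `^ (- alpha)
    * \int[mu]_(t in D) (w t * (k%:R * (sin t * cos t ^+ k.-1))).
Proof.
move=> k0; rewrite -RintegralZl //; last exact: integrable_logcos_sin_cosX.
by rewrite /Gamma /Rintegral; congr fine; exact: ge0_integral_Gamma_logcos.
Qed.

Lemma has_integral_logcos (k : nat) :
  has_integral D (fun t => w t * (k%:R * (sin t * cos t ^+ k.-1)))
    (Gamma (1 - alpha) * k%:R `^ alpha).
Proof.
split; first exact: integrable_logcos_sin_cosX.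
case: k => [|k].
  rewrite powR0 ?gt_eqF // mulr0.
  under eq_Rintegral do rewrite mul0r mulr0.
  by rewrite Rintegral_cst // mul0r.
rewrite (Gamma_logcos k.+1) // mulrAC powRN mulVf ?mul1r //.
Qed.

(** By the case k = 1 of has_integral_logcos, Gamma(1 - alpha) is the integral of
    w sin over ]0, pi/2[.  Since w >= cos^alpha >= cos, it is at least the
    integral of sin cos, that is 1/2. *)
Lemma Gamma_gt0 : 0 < Gamma (1 - alpha).
Proof.
have mD : measurable D by exact: measurable_itv.
have h1 := has_integral_logcos 1; rewrite powR1 mulr1 in h1.
have h2 := @has_integral_sin_cosX R 2.
have h3 := has_integralZ D _ _ 2 mD h1.
have := has_integral_le D _ _ _ _ mD h2 h3.
suff H : forall t, D t -> 2%:R * (sin t * cos t ^+ 2.-1)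
    <= 2 * (w t * (1%:R * (sin t * cos t ^+ 1.-1))).
  by move=> /(_ H); rewrite /=; lra.
move=> t /=; rewrite in_itv /= => t0.
have /andP[s0 s1] := sin_oo t t0; have /andP[c0 c1] := cos_oo t t0.
have /and3P[l0 l1 l2] := log_cos_bounds t t0.
rewrite expr1 expr0 mulr1 mul1r ler_pM2l // mulrC ler_pM2r //.
apply: (@le_trans _ _ (cos t `^ alpha)).
  apply: ger1_powR; first by rewrite c0 ltW.
  by apply: ltW; apply: lt_trans alpha_lt _; lra.
have L0 : 0 < - ln (cos t) by exact: lt_le_trans l0 l1.
rewrite /logcos_weight powRN -[leLHS]invrK lef_pV2 ?posrE ?invr_gt0 ?powR_gt0 //.
rewrite -powRN -(mulN1r alpha) powRrM powR_inv1 ?(ltW c0) //.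
by apply: ge0_ler_powR; rewrite ?nnegrE ?(ltW alpha_gt0) ?invr_ge0 ?(ltW c0)
  ?(ltW L0).
Qed.

(** Compare w with w sin, whose integral is Gamma(1 - alpha). *)
Lemma K_gt0 : 0 < K_ alpha.
Proof.
have mD : measurable D by exact: measurable_itv.
have iw := integrable_logcos_weight alpha alpha_gt0 alpha_lt.
have h1 := has_integral_logcos 1; rewrite powR1 mulr1 in h1.
rewrite /K_ mulr_gt0 ?invr_gt0 ?Gamma_gt0 //.
apply: (lt_le_trans Gamma_gt0).
apply: (has_integral_le D _ _ _ _ mD h1 (conj iw erefl)) => t /=.
rewrite in_itv /= => t0; have /andP[s0 s1] := sin_oo t t0.
by rewrite expr0 mulr1 mul1r ler_piMr // logcos_weight_ge0.
Qed.

End GammaLogCos.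

(** * Exponential integrability *)
Section Conclusion.
Context {R : realType} {n : nat}.
Local Notation C := (R[i]).
Implicit Types (f : cube n -> C) (x : cube n).

Lemma mean_le (g : cube n -> R) (B : R) : (forall x, g x <= B) -> mean g <= B.
Proof.
move=> gB; have c0 : 0 < #|cube n|%:R :> R.
  by rewrite ltr0n; apply/card_gt0P; exists [ffun=> false].
rewrite /mean ler_pdivrMr // mulr_natr -sumr_const.
by apply: ler_sum => x _; exact: gB.
Qed.

Lemma mean_expR_sup (c : R) f : 0 <= c ->
  mean (fun x => expR (c * grad_norm f x ^+ 2))
  <= expR (c * sup_norm (grad_norm f) ^+ 2).
Proof.
move=> c0; apply: mean_le => x; rewrite ler_expR ler_wpM2l //.
have g0 : 0 <= grad_norm f x by exact: sqrtr_ge0.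
have gs : grad_norm f x <= sup_norm (grad_norm f) by exact: le_bigmax.
by rewrite ler_sqr ?nnegrE // (le_trans g0 gs).
Qed.

Lemma fourier_multiplier_center f x :
  fourier_multiplier (fun k => (0 < k)%:R) f x = f x - mean f.
Proof.
rewrite (fourier_inversion f x) (bigD1 finset.set0) //=.
have -> : fourier_coef f finset.set0 * walsh C finset.set0 x = mean f.
  rewrite /walsh big_set0 mulr1 /fourier_coef; congr (_ / _).
  by apply: eq_bigr => y _; rewrite /walsh big_set0 mulr1.
rewrite addrAC subrr add0r /fourier_multiplier (bigD1 finset.set0) //=.
rewrite cards0 rmorph0 !mul0r.
rewrite add0r; apply: eq_bigr => A A0.
by rewrite card_gt0 A0 rmorph1 mul1r.
Qed.

(** The factor 4^alpha of the eigenvalues (4 |A|)^alpha is moved to f, where it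
    is absorbed later by 4^(2 alpha) <= 4. *)
Lemma frac_laplacian_multiplier (alpha : R) f x : alpha != 0 ->
  frac_laplacian alpha f x =
  fourier_multiplier (fun k => k%:R `^ alpha) (fun y => (4 `^ alpha)%:C * f y) x.
Proof.
move=> a0; rewrite fourier_multiplierZ /fourier_multiplier.
rewrite (bigD1 finset.set0) //= cards0 powR0 // rmorph0.
rewrite !mul0r add0r mulr_sumr; apply: eq_bigr => A A0.
by rewrite natrM powRM // rmorphM -!mulrA.
Qed.

Lemma exp_integrability_center f :
  mean (fun x => expR (cmod (f x - mean f)))
  <= 2 * mean (fun x => expR (pi ^+ 2 / 32 * grad_norm f x ^+ 2)).
Proof.
have K0 : 0 < pi / 2 :> R by rewrite divr_gt0 ?pi_gt0.
have := mean_exp_multiplier_le `]0, (pi / 2)[%classic (fun=> 1) (pi / 2)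
  (fun k => (0 < k)%:R) f (measurable_itv _) K0 (fun _ _ => ler01)
  has_integral1_pihalf.
have -> : (pi / 2) ^+ 2 / 8 = pi ^+ 2 / 32 :> R by field.
have -> : (fun x => expR (cmod (fourier_multiplier (fun k => (0 < k)%:R) f x)))
    = (fun x => expR (cmod (f x - mean f))).
  by apply/funext => x; rewrite fourier_multiplier_center.
apply=> k; have := @has_integral_sin_cosX R k.
by under [X in has_integral _ X]funext do rewrite -[_ * _]mul1r.
Qed.

Lemma exp_integrability_frac_laplacian (alpha : R) f :
  0 < alpha -> alpha < 1 / 2 ->
  mean (fun x => expR (cmod (frac_laplacian alpha f x)))
  <= 2 * mean (fun x => expR (1 / 2 * K_ alpha ^+ 2 * grad_norm f x ^+ 2)).
Proof.
move=> a0 a1.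
have mD : measurable (`]0, (pi / 2)[%classic : set (measurableTypeR R)).
  exact: measurable_itv.
have G0 := Gamma_gt0 alpha a0 a1.
have iw : has_integral `]0, (pi / 2)[%classic
    (fun t => (Gamma (1 - alpha))^-1 * logcos_weight alpha t) (K_ alpha).
  apply: has_integralZ => //.
  by split; first exact: integrable_logcos_weight.
have ip k : has_integral `]0, (pi / 2)[%classic
    (fun t => (Gamma (1 - alpha))^-1 * logcos_weight alpha t
      * (k%:R * (sin t * cos t ^+ k.-1))) (k%:R `^ alpha).
  have := has_integralZ _ _ _ (Gamma (1 - alpha))^-1 mD
    (has_integral_logcos alpha a0 a1 k).
  rewrite mulKf ?gt_eqF //.
  by under [X in has_integral _ X]funext do rewrite mulrA.
have := mean_exp_multiplier_le _ _ _ _ (fun y => (4 `^ alpha)%:C * f y)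
  mD (K_gt0 alpha a0 a1) _ iw ip.
have -> : (fun x => expR (cmod (fourier_multiplier (fun k => k%:R `^ alpha)
      (fun y => (4 `^ alpha)%:C * f y) x)))
    = (fun x => expR (cmod (frac_laplacian alpha f x))).
  by apply/funext => x; rewrite frac_laplacian_multiplier // gt_eqF.
move=> H; apply: le_trans (H _) _.
  by move=> t _; rewrite mulr_ge0 ?invr_ge0 ?(ltW G0) ?logcos_weight_ge0.
rewrite ler_pM2l // /mean ler_wpM2r ?invr_ge0 ?ler0n //.
apply: ler_sum => x _; rewrite ler_expR grad_normZ mulrA.
rewrite ler_wpM2r ?sqr_ge0 //.
have h4 : (4 `^ alpha) ^+ 2 <= 4 :> R.
  rewrite -powR_mulrn ?powR_ge0 // -powRrM.
  by rewrite -[leRHS]powRr1 // ler_powR //; lra.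
have := sqr_ge0 (K_ alpha); nra.
Qed.

End Conclusion.

Theorem corollary4p1 (R : realType) (n : nat) (hn : (0 < n)%N)
    (f : cube n -> R[i]) :
  (mean (fun x => expR (cmod (f x - mean f)))
     <= 2 * mean (fun x => expR (pi ^+ 2 / 32 * grad_norm f x ^+ 2))
   /\ 2 * mean (fun x => expR (pi ^+ 2 / 32 * grad_norm f x ^+ 2))
     <= 2 * expR (pi ^+ 2 / 32 * sup_norm (grad_norm f) ^+ 2))
  /\
  (forall alpha : R, 0 < alpha -> alpha < 1 / 2 ->
     mean (fun x => expR (cmod (frac_laplacian alpha f x)))
       <= 2 * mean (fun x => expR (1 / 2 * K_ alpha ^+ 2 * grad_norm f x ^+ 2))
     /\ 2 * mean (fun x => expR (1 / 2 * K_ alpha ^+ 2 * grad_norm f x ^+ 2))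
       <= 2 * expR (1 / 2 * K_ alpha ^+ 2 * sup_norm (grad_norm f) ^+ 2)).
Proof.
split=> [|alpha a0 a1]; split.
- exact: exp_integrability_center.
- by rewrite ler_pM2l // mean_expR_sup // divr_ge0 ?sqr_ge0.
- exact: exp_integrability_frac_laplacian.
- by rewrite ler_pM2l // mean_expR_sup // mulr_ge0 ?sqr_ge0 ?divr_ge0.
Qed.
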